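(* Let $H_m(g,t,f,e,D)$ be the number of multirooted hypermaps of genus $g$ with $t$ darts, $f$ faces and $e$ hyperedges such that $D$ is the list of degrees of the initial vertices of the distinguished darts. Then $H_m(0,0,1,0,[0])=1$ and, if $t\ge 1$ and $n\ge 1$, then for all integers $g,f,e\ge 0$ and every finite (possibly empty) list $D=[d_1,\dots,d_{|D|}]$ of positive integers, $$H_m(g,t,f,e,n.D)=\sum_{\substack{g_1+g_2=g\\ t_1+t_2=t-1\\ f_1+e_2=e\\ f_2+e_1=f\\ n_1+n_2=n-1\\ D_1\subseteq D}} H_m(g_1,t_1,f_1,e_1,n_1.D_1)\,H_m(g_2,t_2,f_2,e_2,n_2.(D-D_1))$$ $$+\ \delta_{n\ge 3}\,\delta_{g\ge 1}\sum_{p=1}^{n-2}H_m(g-1,t-1,e,f,(n-1-p).p.D)\ +\ \sum_{p=n}^{t-1}H_m(g,t-1,e,f,p.D)$$ $$+\ \sum_{j=1}^{|D|}d_j\,H_m(g,t-1,e,f,(d_j+n-1).(D-\{d_j\})).$$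
   Context: A (combinatorial) hypermap is a triple $(\Omega,R,L)$ where $\Omega$ is a finite set of darts and $R,L$ are permutations of $\Omega$ such that the group $\langle R,L\rangle$ acts transitively on $\Omega$. The orbits of $R$, $L$ and $RL$ ($L$ followed by $R$) are the vertices, hyperedges and faces; the degree of a vertex is the number of darts in it, and the initial vertex of a dart is the vertex containing it. The genus $g$ of a hypermap with $t$ darts, $v$ vertices, $e$ hyperedges and $f$ faces is given by $v+e+f=t+2(1-g)$. By convention there is also a unique empty hypermap (no darts), with $v=f=1$ and $g=e=0$; its single vertex has degree $0$. For $\rho\ge 1$, a $\rho$-rooted hypermap is a hypermap in which a sequence of $\rho$ darts with pairwise distinct initial vertices is distinguished; its degree list is $[d_1,\dots,d_\rho]$, with $d_i$ the degree of the initial vertex of the $i$-th distinguished dart. By convention, the empty hypermap is regarded as a $1$-rooted hypermap with degree list $[0]$. A multirooted hypermap is a $\rho$-rooted hypermap for some $\rho\ge 1$. Multirooted hypermaps are counted up to isomorphism (bijections of darts commuting with $R$ and $L$ and preserving the sequence of distinguished darts). In $H_m(g,t,f,e,D)$ the third argument is the number of faces and the fourth is the number of hyperedges; these two arguments are interchanged in several terms. Conventions: $D_1\subseteq D$ means that $D_1$ is a sublist of $D$, sublists being indexed by subsets of positions, and $D-D_1$ is the complementary sublist; $D-\{d_j\}$ is $D$ with its $j$-th element removed; $i.D$ is $D$ with $i$ put in front. Summation indices $g_i,t_i,f_i,e_i,n_i$ are nonnegative integers; sums over empty ranges are $0$. $\delta_\varphi$ is $1$ if $\varphi$ is true and $0$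 otherwise. *)

(* Defs.v *)
From mathcomp Require Import all_boot all_fingroup.

Set Implicit Arguments.
Unset Strict Implicit.
Unset Printing Implicit Defensive.

Import GroupScope.
Local Open Scope nat_scope.

(* [transitive _, on S | _] requires S to be nonempty, so this covers exactly
   the nonempty hypermaps; the empty one is handled in [Hm]. *)
Definition is_hypermap (T : finType) (R L : {perm T}) : bool :=
  [transitive <<[set R; L]>>, on [set: T] | 'P].

Definition nb_vertices (T : finType) (R L : {perm T}) : nat := #|porbits R|.

Definition nb_hyperedges (T : finType) (R L : {perm T}) : nat := #|porbits L|.

(* The product of permutations is read from left to right, [(L * R) x = R (L x)]:
   this is "L followed by R". *)
Definition nb_faces (T : finType) (R L : {perm T}) : nat :=
  #|porbits (L * R)%g|.

(* v + e + f = t + 2 (1 - g), with 2 g moved to the left-hand side to avoid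
   subtraction. *)
Definition has_genus (T : finType) (R L : {perm T}) (g : nat) : bool :=
  nb_vertices R L + nb_hyperedges R L + nb_faces R L + 2 * g == #|T| + 2.

Definition initial_vertex (T : finType) (R : {perm T}) (x : T) : {set T} :=
  porbit R x.

Definition rooted_triple (T : finType) (rho : nat) : finType :=
  ({perm T} * {perm T} * rho.-tuple T)%type.

Definition is_rooted_hypermap (T : finType) (rho : nat)
    (h : rooted_triple T rho) : bool :=
  let: (R, L, s) := h in
  [&& is_hypermap R L, 0 < rho & uniq (map (initial_vertex R) s)].

Definition degree_list (T : finType) (rho : nat) (h : rooted_triple T rho) :
    seq nat :=
  let: (R, _, s) := h in [seq #|initial_vertex R x| | x <- s].

Definition rooted_iso (T : finType) (rho : nat) : rel (rooted_triple T rho) :=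
  fun h h' =>
    let: (R, L, s) := h in
    let: (R', L', s') := h' in
    [exists phi : {perm T},
      [&& [forall x, phi (R x) == R' (phi x)],
          [forall x, phi (L x) == L' (phi x)] &
          map phi s == s' :> seq T]].

Definition rooted_hypermaps (T : finType) (g f e : nat) (D : seq nat) :
    {set rooted_triple T (size D)} :=
  [set h | let: (R, L, _) := h in
    [&& is_rooted_hypermap h, has_genus R L g, nb_faces R L == f,
        nb_hyperedges R L == e & degree_list h == D]].

(* For t >= 1, every hypermap with t darts is isomorphic to one whose set of
   darts is 'I_t, so the isomorphism classes are those of the relation
   [rooted_iso] over 'I_t. For t = 0 there is only the empty hypermap, which has
   genus 0, one face and no hyperedge, and is by convention 1-rooted with degree
   list [:: 0]. *)
Definition Hm (g t f e : nat) (D : seq nat) : nat :=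
  if t == 0 then nat_of_bool [&& g == 0, f == 1, e == 0 & D == [:: 0]]
  else #|equivalence_partition (@rooted_iso 'I_t (size D))
                               (rooted_hypermaps 'I_t g f e D)|.

Definition remove_nth (T : Type) (j : nat) (s : seq T) : seq T :=
  take j s ++ drop j.+1 s.

(* Main.v *)
Require Import Defs.
From mathcomp Require Import all_boot all_fingroup.
From mathcomp Require Import zify.

(** The proof counts labelled hypermaps and divides at the end. A relabelling
    of the darts that fixes a rooted hypermap fixes the first root, hence, by
    transitivity, every dart; so the symmetric group acts freely, an isomorphism
    class with [t] darts consists of [t!] labelled rooted hypermaps, and
    [(t-1)!] of them have a prescribed dart as first root ([rooted_count_Hm]).
    Once [R] is known, the remaining roots only matter through their number
    [nroot], which is defined by recursion on the degree list. The recurrence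
    thereby becomes an identity between sums over pairs of permutations.

    Let [x0] be the first root. Skip [x0] both in the cycles of [L] and in the
    cycles of the face permutation [L * R], and call [L'] and [L' * R'] the two
    permutations of the other darts obtained in this way, extended so that they
    fix [x0]. With [y = L x0], and [b] the dart that [R'] sends to the successor
    of [x0] in its face, one finds
      [R = tperm x0 y * tperm x0 b * R'],  [L = L' * tperm x0 y],
      [L * R = (L' * R') * tperm x0 (R' b)],
    and [(R, L) |-> (R', L', y, b)] is a bijection when [y] and [b] range over
    all darts, [x0] included ([sum_ins]). Inserting [x0] changes no other
    hyperedge and no other face; it creates a new hyperedge exactly if [y = x0]
    and a new face exactly if [b = x0]. What happens to the vertices is the
    source of the terms of the recurrence.
    - If [y] and [b] lie in one cycle of [R'], of length [p], that cycle is cut: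
      [n - 1] of its darts join [x0], and the other [p - n + 1] form a vertex,
      which has no root (third sum), or carries the [j]-th root at one of its
      [d_j] darts (last sum). This is [sum_same_vertex].
    - If [y] and [b] lie in distinct cycles of one component, these cycles are
      merged and the genus goes up by one: second sum, [sum_same_component].
    - If the components of [y] and [b] are disjoint, two hypermaps are joined
      at [x0]: first sum, [sum_separated]. The cases [y = x0] and [b = x0] are
      those where one of the two hypermaps is empty, and the convention that the
      empty hypermap has one vertex and one face makes the formula uniform. The
      factorials of the labelled counts absorb the binomial coefficient that
      counts the ways to distribute the darts ([conv_subsets]).

    The involution [(R, L) |-> (R^-1, L * R)] keeps the vertices and exchanges
    hyperedges with faces; it accounts for the interchanged arguments
    ([Hm_dual]). That every connected pair has a genus, which is needed to split
    the genus in the third case and to exclude genus [0] in the second, follows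
    from the same deletion by induction ([euler_genus]). *)

Set Implicit Arguments.
Unset Strict Implicit.
Unset Printing Implicit Defensive.

Import GroupScope.
Local Open Scope nat_scope.

(** * Stable sets, cycles and components *)

Section Stable.
Variable T : finType.
Implicit Types (R L s u : {perm T}) (A B V W : {set T}) (x y z : T).

Definition stable s A := forall x, (s x \in A) = (x \in A).

Lemma stable_sub s A : {in A, forall x, s x \in A} -> stable s A.
Proof.
move=> sA x; have sAA : s @: A \subset A.
  by apply/subsetP=> _ /imsetP[z zA ->]; apply: sA.
have /eqP eqA : s @: A == A.
  by rewrite eqEcard sAA (card_imset _ (@perm_inj _ s)) leqnn.
by rewrite -{1}eqA (mem_imset _ _ (@perm_inj _ s)).
Qed.

Lemma stableM s u A : stable s A -> stable u A -> stable (s * u) A.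
Proof. by move=> sA uA x; rewrite permM uA sA. Qed.

Lemma stableV s A : stable s A -> stable s^-1 A.
Proof. by move=> sA x; rewrite -[in LHS]sA permKV. Qed.

Lemma stable_tperm x y A : x \in A -> y \in A -> stable (tperm x y) A.
Proof. by move=> xA yA z; case: tpermP => [->|->|//]; rewrite xA yA. Qed.

Lemma stableU s A B : stable s A -> stable s B -> stable s (A :|: B).
Proof. by move=> sA sB x; rewrite !inE sA sB. Qed.

Lemma stableD s A B : stable s A -> stable s B -> stable s (A :\: B).
Proof. by move=> sA sB x; rewrite !inE sA sB. Qed.

Lemma stableT s : stable s setT.
Proof. by move=> x; rewrite !inE. Qed.

Lemma stable1 s x : s x = x -> stable s [set x].
Proof. by move=> sx; apply: stable_sub => z /set1P->; rewrite sx set11. Qed.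

Lemma stableC s A : stable s A -> stable s (~: A).
Proof. by move=> sA x; rewrite !inE sA. Qed.

Lemma stable_on s A : perm_on A s -> stable s A.
Proof. by move=> sA x; apply: perm_closed. Qed.

Lemma stable_porbit s x : stable s (porbit s x).
Proof.
move=> z; rewrite -!eq_porbit_mem.
by rewrite -[s z]/((s ^+ 1) z) porbit_perm.
Qed.

Lemma porbit_sub s A x : stable s A -> x \in A -> porbit s x \subset A.
Proof.
move=> sA xA; apply/subsetP => _ /porbitP[i ->].
by elim: i => [|i IH]; rewrite ?expg0 ?perm1 // expgSr permM sA.
Qed.

Lemma porbit_disjoint s x y : y \notin porbit s x ->
  [disjoint porbit s x & porbit s y].
Proof.
move=> yx; rewrite disjoint_subset; apply/subsetP=> z zx; rewrite inE.
apply: contra yx => zy; rewrite -eq_porbit_mem.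
by move: zx zy; rewrite -!eq_porbit_mem => /eqP<- /eqP<-.
Qed.

Lemma eq_in_porbit s u A x :
  stable s A -> {in A, s =1 u} -> x \in A -> porbit s x = porbit u x.
Proof.
move=> sA esu xA.
have eqX i : (s ^+ i) x = (u ^+ i) x /\ (s ^+ i) x \in A.
  elim: i => [|i [IH IA]]; first by rewrite !expg0 !perm1.
  by rewrite !expgSr !permM sA -IH esu.
by apply/setP=> z; apply/porbitP/porbitP => -[i ->]; exists i; rewrite (eqX i).1.
Qed.

Lemma stable_eq_in s u A : stable s A -> {in A, s =1 u} -> stable u A.
Proof. by move=> sA esu; apply: stable_sub => x xA; rewrite -esu // sA. Qed.

Definition ncyc A s := #|[set porbit s x | x in A]|.

Lemma eq_in_ncyc s u A : stable s A -> {in A, s =1 u} -> ncyc A s = ncyc A u.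
Proof.
move=> sA esu; congr #|pred_of_set _|; apply: eq_in_imset => x xA.
exact: eq_in_porbit sA esu xA.
Qed.

Lemma ncyc_setT s : ncyc setT s = #|porbits s|.
Proof.
congr #|pred_of_set _|; apply/setP => B.
by apply/imsetP/imsetP => -[x _ ->]; exists x.
Qed.

Lemma ncycU s A B : stable s A -> stable s B -> [disjoint A & B] ->
  ncyc (A :|: B) s = ncyc A s + ncyc B s.
Proof.
move=> sA sB dAB; rewrite /ncyc imsetU cardsU.
rewrite (_ : _ :&: _ = set0) ?cards0 ?subn0 //.
apply/setP=> C; rewrite !inE; apply/negbTE/negP=> /andP[/imsetP[x xA ->]].
case/imsetP=> y yB /setP/(_ x); rewrite porbit_id => /esym xy.
have := subsetP (porbit_sub sB yB) _ xy.
by rewrite (disjointFr dAB).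
Qed.

Lemma ncycC s A : stable s A -> ncyc A s + ncyc (~: A) s = #|porbits s|.
Proof.
move=> sA; rewrite -ncycU ?setUCr ?ncyc_setT //; first exact: stableC.
by rewrite -setI_eq0 setICr.
Qed.

Lemma ncyc0 s : ncyc set0 s = 0.
Proof. by rewrite /ncyc imset0 cards0. Qed.

Lemma ncyc1 s x : ncyc [set x] s = 1.
Proof. by rewrite /ncyc imset_set1 cards1. Qed.

Lemma ncycD1 s A x : stable s A -> s x = x -> x \in A -> ncyc A s = (ncyc (A :\ x) s).+1.
Proof.
move=> sA sx xA; rewrite -{1}(setD1K xA) ncycU ?ncyc1 //; first exact: stable1.
  exact/stableD/stable1.
by rewrite disjoints1 !inE eqxx.
Qed.

(** From the same formula for all the cycles, [porbits_mul_tperm]: the product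
    with the transposition changes nothing outside [A]. *)
Lemma ncyc_mul_tperm s A x y : stable s A -> x \in A -> y \in A ->
  ncyc A (tperm x y * s) + (x \notin porbit s y).*2 = ncyc A s + (x != y).
Proof.
move=> sA xA yA; have := porbits_mul_tperm s x y; cbv zeta.
have stA : stable (tperm x y * s) A by apply: stableM => //; apply: stable_tperm.
rewrite -(ncycC sA) -(ncycC stA).
have -> : ncyc (~: A) (tperm x y * s) = ncyc (~: A) s.
  apply: eq_in_ncyc; first exact: stableC.
  by move=> z; rewrite inE permM => zA; case: tpermP zA => [->|->|//]; rewrite ?xA ?yA.
lia.
Qed.

(** In the product, the cycle of [x] starts with [s y] and follows [s] until it
    comes back to [y], then jumps to [s x] and follows [s] again. *)
Lemma porbit_merge s x y : x \notin porbit s y ->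
  porbit (tperm x y * s) x = porbit s x :|: porbit s y.
Proof.
move=> xy; set u := (tperm x y * s)%g.
have sZ : stable u (porbit s x :|: porbit s y).
  apply: stableM; first by apply: stable_tperm; rewrite inE porbit_id ?orbT.
  by apply: stableU; apply: stable_porbit.
apply/eqP; rewrite eqEsubset porbit_sub ?inE ?porbit_id //=.
have ux : u x = s y by rewrite permM tpermL.
have uy : u y = s x by rewrite permM tpermR.
have uz z : z != x -> z != y -> u z = s z by move=> *; rewrite permM tpermD // eq_sym.
have stW := @stable_porbit u x; set W := porbit u x in stW *.
have xW : x \in W by apply: porbit_id.
have yx i : (s ^+ i) y != x by apply: contraNneq xy => <-; apply: mem_porbit.
have xy' i : (s ^+ i) x != y.
  by apply: contraNneq xy => <-; rewrite porbit_sym; apply: mem_porbit.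
have syW : s y \in W by rewrite -ux stW.
have yW i : (s ^+ i.+1) y \in W.
  elim: i => [//|i IH]; rewrite expgSr permM.
  by have [->|ny] := eqVneq ((s ^+ i.+1) y) y; rewrite // -uz // stW.
have yyW : y \in W.
  have := yW #|porbit s y|.-1.
  by rewrite prednK ?permX ?iter_porbit // lt0n card_porbit_neq0.
have sxW : s x \in W by rewrite -uy stW.
have xxW i : (s ^+ i.+1) x \in W.
  elim: i => [//|i IH]; rewrite expgSr permM.
  by have [->|nx] := eqVneq ((s ^+ i.+1) x) x; rewrite // -uz // stW.
by apply/subsetP=> z /setUP[] /porbitP[[|i] ->]; rewrite ?expg0 ?perm1.
Qed.

(** The hypermap that contains a dart. Transitivity on a set amounts to being
    one component, and the two lemmas on stability and [component_sub]
    characterize components without reference to the generated group. *)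
Definition component R L x := orbit 'P <<[set R; L]>> x.

Lemma component_id R L x : x \in component R L x.
Proof. exact: orbit_refl. Qed.

Lemma component_stableR R L x : stable R (component R L x).
Proof.
apply: stable_sub => y yC; rewrite /component -(orbit_eqP yC).
by apply: (mem_orbit 'P); rewrite mem_gen // !inE eqxx.
Qed.

Lemma component_stableL R L x : stable L (component R L x).
Proof.
apply: stable_sub => y yC; rewrite /component -(orbit_eqP yC).
by apply: (mem_orbit 'P); rewrite mem_gen // !inE eqxx orbT.
Qed.

Lemma component_sub R L x A :
  stable R A -> stable L A -> x \in A -> component R L x \subset A.
Proof.
move=> RA LA xA; apply/subsetP=> _ /orbitP[a aG <-].
have : <<[set R; L]>> \subset 'N(A | 'P).
  rewrite gen_subG; apply/subsetP => s sRL; rewrite !inE /=.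
  by apply/subsetP => z zA; rewrite !inE /aperm; case/set2P: sRL => ->; rewrite ?RA ?LA.
by move/subsetP/(_ _ aG)/astabs_act => ->.
Qed.

Lemma component_eqP R L x y : y \in component R L x -> component R L y = component R L x.
Proof. by move/orbit_eqP. Qed.

Lemma component_sym R L x y : (x \in component R L y) = (y \in component R L x).
Proof. exact: orbit_sym. Qed.

Lemma transitiveE R L A x : x \in A ->
  [transitive <<[set R; L]>>, on A | 'P] = (component R L x == A).
Proof.
move=> xA; apply/idP/eqP => [/atransP/(_ x xA) //|<-]; exact: atrans_orbit.
Qed.

Lemma eq_in_component R L R' L' A x : stable R A -> stable L A ->
  {in A, R =1 R'} -> {in A, L =1 L'} -> x \in A -> component R L x = component R' L' x.
Proof.
move=> RA LA eR eL xA.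
have RA' := stable_eq_in RA eR; have LA' := stable_eq_in LA eL.
have CA : component R L x \subset A by apply: component_sub.
have CA' : component R' L' x \subset A by apply: component_sub.
apply/eqP; rewrite eqEsubset; apply/andP; split; apply: component_sub; rewrite ?component_id //;
  apply: stable_sub => z zC.
- by rewrite eR ?(subsetP CA') // component_stableR.
- by rewrite eL ?(subsetP CA') // component_stableL.
- by rewrite -eR ?(subsetP CA) // component_stableR.
- by rewrite -eL ?(subsetP CA) // component_stableL.
Qed.

Lemma porbit_sub_component R L x y :
  y \in component R L x -> porbit R y \subset component R L x.
Proof. by apply: porbit_sub; apply: component_stableR. Qed.

End Stable.

(** * The number of ways to choose the roots *)

Lemma sum_tuple_cons (X : finType) n (F : seq X -> nat) :
  \sum_(s : n.+1.-tuple X) F s = \sum_x \sum_(s : n.-tuple X) F (x :: s).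
Proof.
rewrite pair_big /= (reindex (fun p : X * n.-tuple X => cons_tuple p.1 p.2)) //=.
exists (fun s => (thead s, [tuple of behead s])) => [[x s] _|s _] /=.
  by rewrite theadE; congr pair; apply: val_inj.
by rewrite [RHS]tuple_eta; apply: val_inj.
Qed.

Lemma sum_tuple0 (X : finType) (F : seq X -> nat) :
  \sum_(s : 0.-tuple X) F s = F [::].
Proof.
by rewrite (big_pred1 [tuple]) // => s; rewrite [s]tuple0 /= eq_refl.
Qed.

Section Nroot.
Variable T : finType.
Implicit Types (R L s u : {perm T}) (A B V W : {set T}) (x y z : T) (D : seq nat).

(** The number of sequences of darts of [V] that lie in distinct cycles of [R]
    of prescribed lengths: each choice removes a whole cycle. The recursion on
    the list avoids tuples whose size depends on a mask. *)
Fixpoint nroot R V D :=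
  if D is d :: D' then
    \sum_(x in V | #|porbit R x| == d) nroot R (V :\: porbit R x) D'
  else 1.

Lemma eq_in_nroot s u V D : stable s V -> {in V, s =1 u} -> nroot s V D = nroot u V D.
Proof.
elim: D V => //= d D IH V sV esu.
have ep x : x \in V -> porbit s x = porbit u x by apply: eq_in_porbit sV esu.
rewrite (eq_bigl (fun x => (x \in V) && (#|porbit u x| == d))); last first.
  by move=> x; case xV: (x \in V); rewrite //= ep.
apply: eq_bigr => x /andP[xV _]; rewrite -ep //; apply: IH.
  exact/stableD/stable_porbit.
by move=> z /setDP[zV _]; apply: esu.
Qed.

(** The mask records on which side each root is chosen. *)
Lemma nrootU R V1 V2 D : stable R V1 -> stable R V2 -> [disjoint V1 & V2] ->
  nroot R (V1 :|: V2) D = \sum_(m : (size D).-tuple bool)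
     nroot R V1 (mask m D) * nroot R V2 (mask (map negb m) D).
Proof.
elim: D V1 V2 => [|d D IH] V1 V2 R1 R2 dV.
  by rewrite (sum_tuple0 (fun m =>
    nroot R V1 (mask m [::]) * nroot R V2 (mask (map negb m) [::]))).
rewrite (sum_tuple_cons _ (fun m =>
  nroot R V1 (mask m (d :: D)) * nroot R V2 (mask (map negb m) (d :: D)))).
rewrite big_bool /=.
rewrite (eq_bigl [predU [pred x | (x \in V1) && (#|porbit R x| == d)]
   & [pred x | (x \in V2) && (#|porbit R x| == d)]]); last first.
  by move=> x; rewrite !inE andb_orl.
rewrite bigU /=; last first.
  rewrite disjoint_subset; apply/subsetP => x; rewrite !inE => /andP[x1 ->].
  by rewrite (disjointFr dV).
congr (_ + _).
- under [RHS]eq_bigr do rewrite big_distrl /=.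
  rewrite exchange_big /=; apply: eq_bigr => x /andP[x1 _].
  have sx := porbit_sub R1 x1.
  rewrite setDUl (_ : V2 :\: _ = V2); last first.
    by apply/setDidPl; rewrite disjoint_sym; apply: disjointWl dV.
  by apply: IH => //; [exact/stableD/stable_porbit | apply: disjointWl dV; apply: subsetDl].
- under [RHS]eq_bigr do rewrite big_distrr /=.
  rewrite exchange_big /=; apply: eq_bigr => x /andP[x1 _].
  have sx := porbit_sub R2 x1.
  rewrite setDUl (_ : V1 :\: _ = V1); last first.
    by apply/setDidPl; apply: disjointWr dV.
  by apply: IH => //; [exact/stableD/stable_porbit | apply: disjointWr dV; apply: subsetDl].
Qed.

(** A single cycle receives no root, or exactly one, which can be any of its
    darts: this is where the factor [d_j] of the recurrence comes from. *)
Lemma nroot_cycle R y V D : stable R V -> [disjoint porbit R y & V] ->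
  nroot R (porbit R y :|: V) D = nroot R V D +
    \sum_(j < size D) (nth 0 D j == #|porbit R y|) * nth 0 D j * nroot R V (remove_nth j D).
Proof.
elim: D V => [|d D IH] V RV dV; first by rewrite big_ord0.
rewrite /= big_ord_recl /=.
rewrite (eq_bigl [predU [pred x | (x \in porbit R y) && (#|porbit R x| == d)]
   & [pred x | (x \in V) && (#|porbit R x| == d)]]); last first.
  by move=> x; rewrite !inE andb_orl.
rewrite bigU /=; last first.
  rewrite disjoint_subset; apply/subsetP => x; rewrite !inE => /andP[x1 ->].
  by rewrite (disjointFr dV).
rewrite addnCA; congr (_ + _).
  have ec x : x \in porbit R y -> porbit R x = porbit R y.
    by rewrite -eq_porbit_mem => /eqP.
  rewrite [remove_nth _ _]drop0 [LHS](eq_bigr (fun=> nroot R V D)); last first.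
    move=> x; rewrite inE => /andP[/ec-> _].
    rewrite setDUl setDv set0U; congr nroot; apply/setDidPl.
    by rewrite disjoint_sym.
  rewrite sum_nat_const; case: eqVneq => [->|ne].
    rewrite mul1n; congr (_ * _); apply: eq_card => x; rewrite !inE.
    by case: (boolP (x \in _)) => //= /ec->; rewrite eqxx.
  rewrite eq_card0 // => x; rewrite !inE.
  by case: (boolP (x \in _)) => //= /ec->; rewrite eq_sym (negbTE ne).
rewrite (eq_bigr (fun x => nroot R (V :\: porbit R x) D +
   \sum_(j < size D) (nth 0 D j == #|porbit R y|) * nth 0 D j *
       nroot R (V :\: porbit R x) (remove_nth j D))); last first.
  move=> x /andP[xV _]; rewrite setDUl (_ : porbit R y :\: _ = porbit R y).
    apply: IH; first exact/stableD/stable_porbit.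
    by apply: disjointWr dV; apply: subsetDl.
  by apply/setDidPl; apply: disjointWr dV; apply: porbit_sub.
rewrite big_split /=; congr (_ + _).
rewrite exchange_big /=; apply: eq_bigr => j _.
by rewrite /= big_distrr.
Qed.

Lemma card_root_tuples R V D : stable R V ->
  #|[set s : (size D).-tuple T | [&& all (mem V) s, uniq (map (porbit R) s) &
      [seq #|porbit R x| | x <- s] == D]]| = nroot R V D.
Proof.
move=> RV; rewrite -sum1dep_card big_mkcond /=.
elim: D V RV => [|d D IH] V RV /=.
  by rewrite (sum_tuple0 (fun r => if [&& all (mem V) r, uniq (map (porbit R) r) &
     [seq #|porbit R x| | x <- r] == [::]] then 1 else 0)).
rewrite (sum_tuple_cons _ (fun r => if [&& all (mem V) r, uniq (map (porbit R) r) &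
     [seq #|porbit R x| | x <- r] == d :: D] then 1 else 0)).
rewrite [RHS]big_mkcond /=; apply: eq_bigr => x _.
case: ifP => [/andP[xV /eqP xd]|xV]; last first.
  rewrite big1 // => s _; case: ifP => // /and3P[/andP[xV' _] _].
  by rewrite eqseq_cons => /andP[xd _]; rewrite xV' xd in xV.
rewrite -IH; last exact/stableD/stable_porbit.
apply: eq_bigr => s _; congr (if _ then _ else _).
rewrite eqseq_cons xd eqxx xV /=.
have -> : all (mem (V :\: porbit R x)) s = all (mem V) s && (porbit R x \notin map (porbit R) s).
  elim: (tval s) => //= z {}s ->; rewrite !inE negb_or eq_porbit_mem porbit_sym.
  by case: (z \in V); case: (x \in porbit R z); case: (all _ s).
by case: (all _ _) => //=; rewrite andbA.
Qed.

End Nroot.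

(** * Transport of permutations along an injection *)

Lemma sum_reindex_inj (I J : finType) (phi : I -> J) (P : pred J) (F : J -> nat) :
  injective phi -> (forall j, P j -> exists i, phi i = j) ->
  \sum_(j | P j) F j = \sum_(i | P (phi i)) F (phi i).
Proof.
move=> inj_phi surj.
rewrite -(big_imset F (h := phi) (A := [pred i | P (phi i)])) /=; last by move=> i j _ _ /inj_phi.
apply: eq_bigl => j; apply/idP/imsetP => [Pj|[i Pi ->]]; last by rewrite inE in Pi.
by have [i eij] := surj j Pj; exists i; rewrite // inE eij.
Qed.

Lemma imset_setD (S T : finType) (h : S -> T) (A B : {set S}) :
  injective h -> h @: (A :\: B) = h @: A :\: h @: B.
Proof.
move=> h_inj; apply/setP=> y; rewrite inE; apply/imsetP/andP => [[x]|[yB /imsetP[x xA ey]]].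
  by rewrite inE => /andP[xB xA] ->; rewrite !mem_imset.
by exists x; rewrite // inE xA andbT -(mem_imset _ _ h_inj) -ey.
Qed.

Section Transport.
Variables (S T : finType) (h : S -> T).
Hypothesis h_inj : injective h.
Implicit Types (R L s u : {perm S}) (V : {set S}) (x : S).

(** A permutation of [S] acts on [T] through [h], trivially outside the image.
    This compares counts on a subset of the darts with counts on an ordinal,
    and for a bijection it is conjugation. *)
Definition ext_fun R (y : T) := if [pick x | h x == y] is Some x then h (R x) else y.

Lemma ext_funE R x : ext_fun R (h x) = h (R x).
Proof. by rewrite /ext_fun; case: pickP => [z /eqP/h_inj->|/(_ x)]; rewrite ?eqxx. Qed.

Lemma ext_fun_out R y : y \notin h @: setT -> ext_fun R y = y.
Proof.
rewrite /ext_fun => yh; case: pickP => // x /eqP hx.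
by rewrite -hx imset_f in yh.
Qed.

Lemma ext_fun_inj R : injective (ext_fun R).
Proof.
have in_ext y : (ext_fun R y \in h @: setT) = (y \in h @: setT).
  apply/idP/idP => [|/imsetP[x _ ->]]; last by rewrite ext_funE imset_f.
  by apply: contraLR => yh; rewrite ext_fun_out.
move=> y z; have [/imsetP[x _ ->]|yh] := boolP (y \in h @: setT).
  have [/imsetP[x' _ ->]|zh] := boolP (z \in h @: setT).
    by rewrite !ext_funE => /h_inj/perm_inj->.
  move=> E; move: (in_ext z) (in_ext (h x)).
  by rewrite -E (negbTE zh) imset_f // => ->.
have [zh|zh] := boolP (z \in h @: setT); last by rewrite !ext_fun_out.
by move=> E; move: (in_ext z) (in_ext y); rewrite -E zh (negbTE yh) => ->.
Qed.

Definition ext R : {perm T} := perm (@ext_fun_inj R).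

Lemma extE R x : ext R (h x) = h (R x).
Proof. by rewrite permE ext_funE. Qed.

Lemma ext_on R : perm_on (h @: setT) (ext R).
Proof.
by apply/subsetP=> y; rewrite inE; apply: contraR => yh; rewrite permE ext_fun_out.
Qed.

Lemma extM R L : ext (L * R) = (ext L * ext R)%g.
Proof.
apply/permP=> y; rewrite permM; have [/imsetP[x _ ->]|yh] := boolP (y \in h @: setT).
  by rewrite !extE permM.
by rewrite !(out_perm (ext_on _) yh).
Qed.

Lemma ext_inj : injective ext.
Proof.
by move=> R L eRL; apply/permP=> x; apply: h_inj; rewrite -!extE eRL.
Qed.

(** There are [#|S|!] permutations of [S] and as many supported by its image, so
    injectivity of [ext] suffices. *)
Lemma ext_surj (Q : {perm T}) : perm_on (h @: setT) Q -> exists R, ext R = Q.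
Proof.
move=> QA; suff: Q \in ext @: setT by case/imsetP=> R _ ->; exists R.
suff /eqP-> : ext @: setT == [set Q | perm_on (h @: setT) Q] by rewrite inE.
rewrite eqEcard; apply/andP; split.
  by apply/subsetP=> _ /imsetP[R _ ->]; rewrite inE ext_on.
rewrite cardsE card_perm (card_imset _ h_inj) (card_imset _ ext_inj).
by rewrite !cardsT -[#|{perm S}|]cardsT -[#|S|]cardsT -card_perm -cardsE
  subset_leq_card //; apply/subsetP=> R; rewrite !inE.
Qed.

Lemma ext_stable R V : stable R V -> stable (ext R) (h @: V).
Proof.
move=> RV; apply: stable_sub => _ /imsetP[x xV ->].
by rewrite extE imset_f // RV.
Qed.

Lemma ext_porbit R x : porbit (ext R) (h x) = h @: porbit R x.
Proof.
have eX i : (ext R ^+ i) (h x) = h ((R ^+ i) x).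
  by elim: i => [|i IH]; rewrite ?expg0 ?perm1 // !expgSr !permM IH extE.
apply/setP=> y; apply/porbitP/imsetP => [[i ->]|[_ /porbitP[i ->] ->]].
  by exists ((R ^+ i) x); rewrite ?mem_porbit.
by exists i.
Qed.

Lemma ext_component R L x : component (ext R) (ext L) (h x) = h @: component R L x.
Proof.
apply/eqP; rewrite eqEsubset; apply/andP; split.
  apply: component_sub; first exact/ext_stable/component_stableR.
    exact/ext_stable/component_stableL.
  by rewrite imset_f ?component_id.
have: component R L x \subset h @^-1: component (ext R) (ext L) (h x).
  apply: component_sub; rewrite ?inE ?component_id //.
    by move=> y; rewrite !inE -extE component_stableR.
  by move=> y; rewrite !inE -extE component_stableL.
move/subsetP=> sub; apply/subsetP=> _ /imsetP[y /sub yC ->].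
by rewrite inE in yC.
Qed.

Lemma ext_ncyc R V : ncyc (h @: V) (ext R) = ncyc V R.
Proof.
have -> : ncyc (h @: V) (ext R) =
    #|(fun B : {set S} => h @: B) @: [set porbit R x | x in V]|.
  rewrite /ncyc -!imset_comp; congr #|pred_of_set _|.
  by apply: eq_imset => x /=; apply: ext_porbit.
by apply: card_imset; apply: imset_inj.
Qed.

Lemma ext_nroot R V D : nroot (ext R) (h @: V) D = nroot R V D.
Proof.
elim: D V => //= d D IH V.
rewrite big_mkcondr /= big_imset /=; last by move=> x y _ _ /h_inj.
rewrite [RHS]big_mkcondr /=; apply: eq_bigr => x _.
by rewrite ext_porbit (card_imset _ h_inj) -(IH (V :\: _)) imset_setD.
Qed.

End Transport.

(** * Labelled hypermaps on a subset of the darts *)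

Section Conf.
Variable T : finType.
Implicit Types (R L s u : {perm T}) (A B V W : {set T}) (x y z : T) (D : seq nat).

(** On the empty set of darts this gives the conventions for the empty hypermap:
    one vertex and one face, but no hyperedge. *)
Definition ecyc A s := ncyc A s + (A == set0).

(** Permutations of [A] are permutations of [T] supported by [A], so that
    hypermaps on different sets of darts can be multiplied together. Connectedness
    is left out: it is stated at a base dart where one is available. *)
Definition hypermap_on A g f e (h : {perm T} * {perm T}) :=
  [&& perm_on A h.1, perm_on A h.2,
   ecyc A h.1 + ncyc A h.2 + ecyc A (h.2 * h.1) + 2 * g == #|A| + 2,
   ecyc A (h.2 * h.1) == f & ncyc A h.2 == e].

(** The weight of a pair is the number of choices of the roots after [y]. *)
Definition rooted_count A y g f e n D :=
  \sum_(h | [&& hypermap_on A g f e h, component h.1 h.2 y == A & #|porbit h.1 y| == n])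
    nroot h.1 (A :\: porbit h.1 y) D.
End Conf.

Lemma rooted_count_transport (S T : finType) (h : S -> T) x g f e n D :
  injective h ->
  rooted_count (h @: setT) (h x) g f e n D = rooted_count setT x g f e n D.
Proof.
move=> h_inj; rewrite /rooted_count.
rewrite (sum_reindex_inj (phi := fun q : {perm S} * {perm S} =>
  (ext h_inj q.1, ext h_inj q.2))); first last.
- move=> [R L] /=; rewrite /hypermap_on /= => /andP[/and5P[RA LA _ _ _] _].
  have [R' eR] := ext_surj h_inj RA; have [L' eL] := ext_surj h_inj LA.
  by exists (R', L'); rewrite /= eR eL.
- by move=> [R L] [R' L'] /= [/ext_inj-> /ext_inj->].
have n0 : (setT : {set S}) != set0 by apply/set0Pn; exists x; rewrite inE.
have n0' : h @: setT != set0 by apply/set0Pn; exists (h x); rewrite imset_f.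
apply: eq_big => -[R L] /=; last first.
  by move=> _; rewrite ext_porbit -imset_setD ?ext_nroot.
rewrite /hypermap_on /= /ecyc (negbTE n0) (negbTE n0') !ext_on.
rewrite -extM !ext_ncyc ext_component ext_porbit !(card_imset _ h_inj).
rewrite (inj_eq (imset_inj h_inj)).
have pT s : perm_on [set: S] s by apply/subsetP=> z; rewrite !inE.
by rewrite !pT.
Qed.

(** * From labelled hypermaps to isomorphism classes *)

Section Labelled.
Variable T : finType.
Implicit Types (R L : {perm T}) (x y z : T) (D : seq nat).

Lemma card_rooted g f e n D :
  #|rooted_hypermaps T g f e (n :: D)| = \sum_x rooted_count [set: T] x g f e n D.
Proof.
rewrite -sum1_card.
pose hyp h := [&& is_hypermap h.1 h.2, has_genus h.1 h.2 g,
  nb_faces h.1 h.2 == f & @nb_hyperedges T h.1 h.2 == e].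
pose fs (h : {perm T} * {perm T}) := [set s : (size (n :: D)).-tuple T |
  [&& all (mem [set: T]) s, uniq (map (porbit h.1) s) &
      [seq #|porbit h.1 x| | x <- s] == n :: D]].
rewrite (eq_bigl (fun p : rooted_triple T (size (n :: D)) =>
  hyp p.1 && (p.2 \in fs p.1))); last first.
  move=> [[R L] s]; rewrite !inE /hyp /=.
  have -> : all (mem [set: T]) s by apply/allP=> x; rewrite inE.
  set b1 := is_hypermap _ _; set b2 := has_genus _ _ _.
  set b3 := nb_faces _ _ == _; set b4 := nb_hyperedges _ _ == _.
  by case: b1; case: b2; case: b3; case: b4; rewrite ?andbF ?andbT.
rewrite -(pair_big_dep hyp (fun h s => s \in fs h) (fun _ _ => 1)) /=.
rewrite /rooted_count [RHS](exchange_big_dep predT) //=.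
rewrite big_mkcond /=; apply: eq_bigr => -[R L] _.
rewrite (_ : \sum_(s in fs (R, L)) 1 = nroot R setT (n :: D)); last first.
  by rewrite sum1_card; apply: (card_root_tuples (n :: D)); apply: stableT.
rewrite /= big_mkcond /= big_mkcond [RHS]big_mkcond /=.
case hypE: (hyp _); last first.
  rewrite big1 // => x _; case: ifP => // /andP[/and5P[/= _ _ EE F E] /andP[C _]].
  have setT_neq0 : [set: T] == set0 = false by apply/negbTE/set0Pn; exists x.
  move: hypE; rewrite /hyp /is_hypermap (@transitiveE _ _ _ _ x) ?inE //= C.
  rewrite /has_genus /nb_vertices /nb_hyperedges /nb_faces -!ncyc_setT.
  by move: EE F E; rewrite /ecyc setT_neq0 !addn0 cardsT => -> -> ->.
apply: eq_bigr => x _; rewrite inE /=.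
have setT_neq0 : [set: T] == set0 = false by apply/negbTE/set0Pn; exists x.
have pT s : perm_on [set: T] s by apply/subsetP=> z; rewrite !inE.
case/and4P: hypE; rewrite /is_hypermap (@transitiveE _ _ _ _ x) ?inE //= => ->.
rewrite /has_genus /nb_vertices /nb_hyperedges /nb_faces -!ncyc_setT.
by rewrite /hypermap_on /ecyc setT_neq0 !addn0 cardsT /= !pT => -> -> ->.
Qed.

Section Act.
Variable m : nat.
Implicit Types (p q : rooted_triple T m.+1) (phi psi : {perm T}).

Definition relabel phi p : rooted_triple T m.+1 :=
  (ext (@perm_inj _ phi) p.1.1, ext (@perm_inj _ phi) p.1.2, map_tuple phi p.2).

Lemma rooted_isoE p q : rooted_iso p q = [exists phi, q == relabel phi p].
Proof.
case: p q => [[R L] s] [[R' L'] s'] /=; apply: eq_existsb => phi.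
have extP s1 s2 : [forall x, phi ((s1 : {perm T}) x) == (s2 : {perm T}) (phi x)] =
    (s2 == ext (@perm_inj _ phi) s1).
  apply/forallP/eqP => [E|-> x]; last by rewrite extE.
  apply/permP=> x; rewrite -[x](permKV phi) extE; apply/esym/eqP/E.
rewrite !extP -[RHS]/((_, _, _) == (_, _, _)) !xpair_eqE -andbA.
by congr [&& _, _ & _]; rewrite eq_sym.
Qed.

Lemma relabel_rooted g f e n D phi p (sD : size (n :: D) = m.+1) :
  let X := [set h : rooted_triple T m.+1 | let: (R, L, _) := h in
    [&& is_rooted_hypermap h, has_genus R L g, nb_faces R L == f,
        nb_hyperedges R L == e & degree_list h == n :: D]] in
  p \in X -> relabel phi p \in X.
Proof.
case: p => [[R L] s] /=; rewrite !inE /= => /and5P[/andP[H U] G F E D'].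
have im : phi @: setT = setT by apply/setP=> x; rewrite !inE -[x](permKV phi) imset_f.
have [x _] : exists x : T, x \in [set: T] by exists (thead s); rewrite inE.
set inj := @perm_inj _ phi.
rewrite /is_hypermap (@transitiveE _ _ _ _ (phi x)) ?inE // ext_component.
move: H; rewrite /is_hypermap (@transitiveE _ _ _ _ x) ?inE // => /eqP ->.
rewrite im eqxx /=; apply/and5P; split.
- rewrite -map_comp -(map_inj_uniq (imset_inj inj)) -map_comp in U *.
  rewrite (eq_map (_ : _ =1 (fun y => phi @: porbit R y))) // => y /=.
  by rewrite /initial_vertex ext_porbit.
- move: G; rewrite /has_genus /nb_vertices /nb_hyperedges /nb_faces -!ncyc_setT.
  by rewrite -extM -im !ext_ncyc im.
- move: F; rewrite /nb_faces -!ncyc_setT.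
  by rewrite -extM -im !ext_ncyc im.
- move: E; rewrite /nb_hyperedges -!ncyc_setT.
  by rewrite -im !ext_ncyc im.
- rewrite -map_comp -(eqP D'); apply/eqP/eq_map => y /=.
  by rewrite /initial_vertex ext_porbit (card_imset _ inj).
Qed.

(** Freeness of the action: two relabellings with the same effect agree on the
    first root, and the darts on which they agree form a stable set. *)
Lemma relabel_inj p : is_rooted_hypermap p -> injective (relabel^~ p).
Proof.
case: p => [[R L] s] /and3P[H _ _] phi psi; rewrite /relabel /= => -[eR eL es].
have RE x : phi x = psi x -> phi (R x) = psi (R x).
  by move=> e; rewrite -(extE (@perm_inj _ phi) R x) eR e extE.
have LE x : phi x = psi x -> phi (L x) = psi (L x).
  by move=> e; rewrite -(extE (@perm_inj _ phi) L x) eL e extE.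
have e0 : phi (thead s) = psi (thead s).
  by move: es; case/tupleP: s H => x s H; rewrite theadE /= => -[].
have : component R L (thead s) \subset [set x | phi x == psi x].
  apply: component_sub; rewrite ?inE ?e0 // ; apply: stable_sub => x; rewrite !inE => /eqP e.
    by rewrite RE.
  by rewrite LE.
move: H; rewrite /is_hypermap (@transitiveE _ _ _ _ (thead s)) ?inE // => /eqP -> /subsetP sub.
by apply/permP=> x; have := sub x; rewrite !inE => /(_ isT)/eqP.
Qed.

Lemma relabel1 p : relabel 1 p = p.
Proof.
case: p => [[R L] s]; rewrite /relabel /=.
have e1 s1 : ext (@perm_inj T 1) s1 = s1.
  by apply/permP=> x; rewrite -[x in LHS]perm1 extE perm1.
congr (_, _, _); rewrite ?e1 //; apply: val_inj => /=.
by rewrite -[RHS]map_id; apply: eq_map => x; rewrite perm1.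
Qed.

Lemma relabelM phi psi p : relabel (phi * psi) p = relabel psi (relabel phi p).
Proof.
case: p => [[R L] s]; rewrite /relabel /=.
have eM s1 : ext (@perm_inj T (phi * psi)) s1 = ext (@perm_inj T psi) (ext (@perm_inj T phi) s1).
  apply/permP=> x; rewrite -[x](permKV (phi * psi)%g) extE permM.
  by rewrite [in RHS]permM !extE.
congr (_, _, _); rewrite ?eM //; apply: val_inj => /=.
by rewrite -map_comp; apply: eq_map => x; rewrite /= permM.
Qed.

End Act.

Lemma card_rooted_classes g f e n D :
  #|rooted_hypermaps T g f e (n :: D)| =
  (#|T|)`! * #|equivalence_partition (@rooted_iso T (size (n :: D)))
                               (rooted_hypermaps T g f e (n :: D))|.
Proof.
set X := rooted_hypermaps _ _ _ _ _; set E := @rooted_iso _ _.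
have XE phi p : p \in X -> relabel phi p \in X by apply: relabel_rooted.
have Eeq : {in X & &, equivalence_rel E}.
  move=> p q r _ _ _; rewrite /E; split.
    by rewrite rooted_isoE; apply/existsP; exists 1%g; rewrite relabel1.
  rewrite !rooted_isoE => /existsP[phi /eqP ->].
  apply/existsP/existsP => -[psi /eqP->].
    exists (phi^-1 * psi)%g; by rewrite -relabelM mulKVg.
  by exists (phi * psi)%g; rewrite relabelM.
rewrite mulnC; apply: card_uniform_partition (equivalence_partitionP Eeq).
move=> _ /imsetP[p pX ->].
rewrite (_ : [set _ in X | _] = [set relabel phi p | phi : {perm T}]); last first.
  apply/setP=> q; rewrite inE /E rooted_isoE.
  apply/andP/imsetP => [[_ /existsP[phi /eqP->]]|[phi _ ->]].
    by exists phi.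
  by split; [apply: XE | apply/existsP; exists phi].
rewrite card_imset.
  rewrite -[in RHS](cardsT T) -card_perm; apply: eq_card => s; rewrite !inE.
  by symmetry; apply/subsetP=> z; rewrite !inE.
apply: relabel_inj; case: p pX => [[R L] s]; rewrite inE.
by case/and5P.
Qed.
End Labelled.

(** By transport, the count does not depend on the prescribed first root, so each
    of the [#|A|] choices contributes the same share of [#|A|! * Hm]. *)
Lemma rooted_count_Hm (T : finType) (A : {set T}) y g f e n D : y \in A ->
  rooted_count A y g f e n D = (#|A|.-1)`! * Hm g #|A| f e (n :: D).
Proof.
move=> yA; have : 0 < #|A| by apply/card_gt0P; exists y.
have imA : (fun i : 'I_#|A| => enum_val i) @: setT = A.
  apply/setP=> z; apply/imsetP/idP => [[i _ ->]|zA]; first exact: enum_valP.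
  by exists (enum_rank_in yA z); rewrite ?enum_rankK_in.
have h_inj := @enum_val_inj _ (mem A).
have := rooted_count_transport (enum_rank_in yA y) g f e n D h_inj.
rewrite imA enum_rankK_in // => ->.
move: (enum_rank_in _ _); move: #|A| => k i k0.
have same j : rooted_count [set: 'I_k] j g f e n D = rooted_count setT i g f e n D.
  have im : tperm i j @: setT = setT :> {set 'I_k}.
    by apply/setP=> x; rewrite !inE -[x](permKV (tperm i j)) imset_f.
  have := rooted_count_transport i g f e n D (@perm_inj _ (tperm i j)).
  by rewrite im tpermL.
have := card_rooted 'I_k g f e n D.
rewrite (eq_bigr _ (fun j _ => same j)) sum_nat_const card_rooted_classes.
rewrite /Hm (gtn_eqF k0) card_ord.
case: k k0 {same} i => // k _ i /eqP; rewrite factS -mulnA eqn_pmul2l // => /eqP <-.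
by [].
Qed.

(** * Exchanging hyperedges and faces *)

Section Duality.
Variable T : finType.
Implicit Types (R L : {perm T}) (A V : {set T}) (x y : T) (D : seq nat).

Lemma ncycV A R : ncyc A R^-1 = ncyc A R.
Proof. by congr #|pred_of_set _|; apply: eq_imset => x; rewrite porbitV. Qed.

Lemma nrootV R V D : nroot R^-1 V D = nroot R V D.
Proof.
elim: D V => //= d D IH V; apply: eq_big => x; first by rewrite porbitV.
by rewrite porbitV.
Qed.

Lemma component_dual R L x : component R^-1 (L * R) x = component R L x.
Proof.
apply/eqP; rewrite eqEsubset; apply/andP; split; apply: component_sub; rewrite ?component_id //.
- exact/stableV/component_stableR.
- exact/stableM/component_stableR/component_stableL.
- rewrite -[X in stable X]invgK; exact/stableV/component_stableR.
- rewrite -[X in stable X](mulgK R); exact/stableM/component_stableR/component_stableL.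
Qed.

Lemma rooted_count_dual A y g f e n D : y \in A ->
  rooted_count A y g f e n D = rooted_count A y g e f n D.
Proof.
move=> yA; have A0 : A == set0 = false by apply/negbTE/set0Pn; exists y.
rewrite /rooted_count.
rewrite (reindex_inj (h := fun h : {perm T} * {perm T} => (h.1^-1, h.2 * h.1)%g)); last first.
  by move=> [R L] [R' L'] /= [/invg_inj-> /mulIg->].
apply: eq_big => -[R L] /=; last by rewrite porbitV nrootV.
rewrite /hypermap_on /= /ecyc A0 !addn0 mulgK porbitV component_dual ncycV.
have -> : perm_on A R^-1 = perm_on A R.
  by apply/idP/idP => /(@perm_onV _ _); rewrite ?invgK.
have [RA|//] := boolP (perm_on A R).
have -> : perm_on A (L * R)%g = perm_on A L.
  apply/idP/idP => LA; last exact: perm_onM.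
  by rewrite -(mulgK R L); apply: perm_onM => //; apply: perm_onV.
rewrite /= -!andbA (addnAC (ncyc A R)).
by case: (ncyc A L == f); rewrite ?andbF.
Qed.
End Duality.

Lemma Hm_dual g t f e n D : 0 < t -> Hm g t f e (n :: D) = Hm g t e f (n :: D).
Proof.
case: t => // t _.
have := @rooted_count_Hm 'I_t.+1 setT ord0; rewrite cardsT card_ord => H.
have := @rooted_count_dual 'I_t.+1 setT ord0 g f e n D.
rewrite inE !H ?inE // => /(_ isT)/eqP; rewrite eqn_pmul2l ?fact_gt0 //.
by move/eqP.
Qed.

(** * Inserting and deleting the root dart *)

Section Deletion.
Variables (T : finType) (x0 : T).
Implicit Types (R L s u : {perm T}) (A V : {set T}) (x y z b : T) (D : seq nat).

(** For [R] and [L] that fix [x0], this puts [x0] before [y] in a hyperedge and,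
    if [b] is neither [x0] nor [y], after [b] in a vertex. Degenerate choices
    make [x0] a hyperedge of its own ([y = x0]), a face of its own ([b = x0]) or
    a vertex of its own ([b = y]). *)
Definition insR R y b : {perm T} := (tperm x0 y * (tperm x0 b * R))%g.
Definition insL L y : {perm T} := (L * tperm x0 y)%g.

Definition ins (q : ({perm T} * {perm T}) * (T * T)) :=
  (insR q.1.1 q.2.1 q.2.2, insL q.1.2 q.2.1).

(** [U] is the product [tperm x0 b * R] of the insertion to be undone; it sends
    [b] to the fixed point [x0] of [R]. *)
Definition del (h : {perm T} * {perm T}) :=
  let y := h.2 x0 in
  let U := (tperm x0 y * h.1)%g in
  let b := (U^-1)%g x0 in
  ((tperm x0 b * U, h.2 * tperm x0 y)%g, (y, b)).

Lemma tpermKl x y s : (tperm x y * (tperm x y * s))%g = s.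
Proof. by rewrite mulgA tperm2 mul1g. Qed.

Lemma tpermKr x y s : (s * tperm x y * tperm x y)%g = s.
Proof. by rewrite -mulgA tperm2 mulg1. Qed.

Lemma delK h : ins (del h) = h.
Proof. by case: h => R L; rewrite /ins /del /insR /insL /= !tpermKl tpermKr. Qed.

Lemma del_fix h : ((del h).1.1 x0 = x0) * ((del h).1.2 x0 = x0).
Proof.
case: h => R L; rewrite /del /=; split; last by rewrite permM tpermR.
by rewrite permM tpermL permKV.
Qed.

Lemma insK (q : ({perm T} * {perm T}) * (T * T)) :
  q.1.1 x0 = x0 -> q.1.2 x0 = x0 -> del (ins q) = q.
Proof.
case: q => -[R L] [y b] /= Rx Lx; rewrite /del /ins /=.
have -> : insL L y x0 = y by rewrite permM Lx tpermL.
rewrite /insR /insL tpermKl tpermKr.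
have -> : ((tperm x0 b * R)^-1)%g x0 = b.
  by apply: (@perm_inj _ (tperm x0 b * R)%g); rewrite permKV permM tpermR Rx.
by rewrite tpermKl.
Qed.

Lemma sum_ins (F : {perm T} * {perm T} -> nat) (P : pred _) :
  \sum_(h | P h) F h =
  \sum_(q : ({perm T} * {perm T}) * (T * T) |
         (q.1.1 x0 == x0) && (q.1.2 x0 == x0) && P (ins q)) F (ins q).
Proof.
rewrite (reindex_onto ins del) /=; last by move=> h _; rewrite delK.
apply: eq_bigl => q; rewrite andbC; congr (_ && _); apply/eqP/andP => [<-|[/eqP R /eqP L]].
  by rewrite !del_fix.
exact: insK.
Qed.

Lemma insL_E L y : L x0 = x0 -> insL L y = (tperm x0 ((L^-1)%g y) * L)%g.
Proof.
move=> Lx; rewrite /insL -[in LHS](permKV L y) -{1}Lx -tpermJ conjgE.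
by rewrite mulKVg.
Qed.

Lemma porbit_fix s : s x0 = x0 -> porbit s x0 = [set x0].
Proof.
move=> sx; apply/eqP; rewrite eqEsubset sub1set porbit_id andbT.
by apply: porbit_sub; rewrite ?set11 //; apply: stable1.
Qed.

Lemma porbit_neq_fix s y : s x0 = x0 -> (x0 \in porbit s y) = (y == x0).
Proof. by move=> sx; rewrite porbit_sym porbit_fix // inE. Qed.

Section OneL.
Variables (L : {perm T}) (y : T) (A : {set T}).
Hypotheses (Lx : L x0 = x0) (LA : stable L A) (x0A : x0 \in A) (yA : y \in A).

Lemma ncyc_insL : ncyc A (insL L y) = ncyc (A :\ x0) L + (y == x0).
Proof.
have yA' : (L^-1)%g y \in A by rewrite stableV.
have := ncyc_mul_tperm LA x0A yA'.
rewrite insL_E // porbit_neq_fix // (ncycD1 LA Lx x0A).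
rewrite (eq_sym x0).
have -> : (L^-1%g y == x0) = (y == x0) by rewrite (canF_eq (permKV L)) Lx.
case: (y == x0) => /=; lia.
Qed.
End OneL.

Section OneR.
Variables (R : {perm T}) (y b : T).
Hypotheses (Rx : R x0 = x0).
Notation U := (tperm x0 b * R)%g.

(** The face permutation undergoes the same kind of insertion as the hyperedge
    permutation: the two transpositions at [y] cancel. *)
Lemma insF_E L : (insL L y * insR R y b)%g = insL (L * R) (R b).
Proof.
rewrite /insL /insR -!mulgA tpermKl; congr (_ * _)%g.
by rewrite -{2}Rx -tpermJ conjgE mulKVg.
Qed.

Lemma Rb_eq : (R b == x0) = (b == x0).
Proof. by rewrite -{1}Rx (inj_eq (@perm_inj _ R)). Qed.

Lemma porbit_U : porbit U x0 = x0 |: porbit R b.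
Proof.
have [->|nb] := eqVneq b x0; first by rewrite tperm1 mul1g porbit_fix // setUid.
by rewrite porbit_merge ?porbit_fix // porbit_neq_fix.
Qed.

(** Unless [y] and [b] share a cycle, each of the two transpositions merges a
    cycle into that of [x0], or is trivial. *)
Lemma porbit_insR_far : ~~ ((y != x0) && (b \in porbit R y)) ->
  porbit (insR R y b) x0 = x0 |: porbit R y :|: porbit R b.
Proof.
rewrite /insR; have [-> _|ny /= nby] := eqVneq y x0.
  by rewrite tperm1 mul1g porbit_U porbit_fix // setUid.
have eUR : {in porbit R y, R =1 U}.
  move=> z zy; rewrite permM tpermD //.
    by apply: contraNneq ny => E; rewrite -(porbit_neq_fix _ Rx) E.
  by apply: contraNneq nby => ->.
have EU : porbit U y = porbit R y.
  by rewrite (eq_in_porbit (stable_porbit R y) eUR) ?porbit_id.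
rewrite porbit_merge ?porbit_U ?EU ?porbit_neq_fix //.
by rewrite -!setUA [porbit R b :|: _]setUC.
Qed.

Section Count.
Variable A : {set T}.
Hypotheses (RA : stable R A) (x0A : x0 \in A) (yA : y \in A) (bA : b \in A).

(** When they are not trivial, the transposition at [b] merges two cycles, and
    the one at [y] merges two more or, if [y] and [b] share a cycle, splits one. *)
Lemma ncyc_insR :
  ncyc A (insR R y b) +
    (if (y != x0) && (b \in porbit R y) then 0 else (y != x0) + (b != x0))
  = (ncyc (A :\ x0) R).+1.
Proof.
have UA : stable U A by apply: stableM => //; apply: stable_tperm.
have := ncyc_mul_tperm UA x0A yA; rewrite -/(insR R y b).
have := ncyc_mul_tperm RA x0A bA; rewrite porbit_neq_fix // (ncycD1 RA Rx x0A).
rewrite porbit_sym porbit_U !inE (eq_sym x0 b) (eq_sym x0 y) porbit_sym.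
have [->|ny] /= := eqVneq y x0; first by rewrite addn0; lia.
have [by_|nby] /= := boolP (b \in porbit R y); last by lia.
have -> : b != x0.
  by apply: contraNneq ny => eb; rewrite -(porbit_neq_fix _ Rx) -eb.
lia.
Qed.
End Count.
End OneR.

(** The case of a common cycle, with [b] the [i]-th successor of [y]: the new
    cycle of [x0] consists of [x0] and of the darts after [y] up to [b]. *)
Section Cut.
Variables (R : {perm T}) (y : T) (i : nat).
Hypotheses (Rx : R x0 = x0) (ny : y != x0) (ip : i < #|porbit R y|).
Let b := (R ^+ i)%g y.
(* The exponents start at 1: the dart [y] itself stays outside. *)
Let W := x0 |: [set (R ^+ (j : 'I_i).+1)%g y | j in 'I_i].

Lemma expg_porbit_inj j k : j < #|porbit R y| -> k < #|porbit R y| ->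
  (R ^+ j)%g y = (R ^+ k)%g y -> j = k.
Proof.
move=> jp kp; rewrite !permX -!(nth_traject R (n := #|porbit R y|)) //.
move/eqP; rewrite nth_uniq ?size_traject ?uniq_traject_porbit //.
by move/eqP.
Qed.

Lemma expg_neq_x0 j : (R ^+ j)%g y != x0.
Proof.
by apply: contraNneq ny => E; rewrite -(porbit_neq_fix _ Rx) -E mem_porbit.
Qed.

Lemma porbit_insR_cut : porbit (insR R y b) x0 = W.
Proof.
have p0 : 0 < #|porbit R y| by apply: leq_ltn_trans ip.
have Rx0 : insR R y b x0 = if i == 0 then x0 else R y.
  rewrite !permM tpermL; case: eqP => [i0|/eqP i0].
    by rewrite /b i0 expg0 perm1 tpermR.
  rewrite tpermD // 1?eq_sym //; apply: contraNneq i0 => E.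
  by apply/eqP/expg_porbit_inj; rewrite // expg0 perm1.
have Rj j : 0 < j < i -> insR R y b ((R ^+ j)%g y) = (R ^+ j.+1)%g y.
  case/andP=> j0 ji; have jp := ltn_trans ji ip.
  have nx : x0 != (R ^+ j)%g y by rewrite eq_sym expg_neq_x0.
  have nyj : y != (R ^+ j)%g y.
    apply: contraTneq j0 => E.
    by rewrite -(expg_porbit_inj p0 jp) // expg0 perm1.
  have nb : b != (R ^+ j)%g y.
    by apply: contraTneq ji => /expg_porbit_inj <-; rewrite ?ltnn.
  by rewrite !permM !tpermD // expgSr permM.
have Ri : insR R y b b = if i == 0 then R y else x0.
  rewrite !permM; case: (eqVneq i 0) => [i0|i0].
    by rewrite /b i0 expg0 perm1 tpermR tpermL.
  rewrite (@tpermD _ x0 y) ?tpermR //; first by rewrite eq_sym expg_neq_x0.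
  apply: contraNneq i0 => E.
  by apply/eqP/esym/expg_porbit_inj; rewrite // expg0 perm1.
apply/eqP; rewrite eqEsubset; apply/andP; split.
  apply: porbit_sub; last by rewrite !inE eqxx.
  apply: stable_sub => z /setU1P[->|/imsetP[j _ ->]].
    rewrite Rx0; case: eqP => [_|/eqP i0]; rewrite !inE ?eqxx //.
    rewrite -lt0n in i0; apply/orP; right; apply/imsetP; exists (Ordinal i0) => //=.
  have [->|ji] := eqVneq j.+1 i.
    have i0 : i == 0 = false by apply/gtn_eqF/leq_ltn_trans/(ltn_ord j).
    by rewrite -/b Ri i0 !inE eqxx.
  have ji' : j.+1 < i by rewrite ltn_neqAle ji ltn_ord.
  rewrite Rj ?ji' // !inE; apply/orP; right; apply/imsetP.
  by exists (Ordinal ji').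
apply/subsetP=> z /setU1P[->|/imsetP[[j ji] _ ->]] /=; first exact: porbit_id.
elim: j ji => [|j IH] ji.
  by rewrite expg1; move: Rx0; rewrite (gtn_eqF ji) => <-; rewrite stable_porbit porbit_id.
by rewrite -Rj ?ji // stable_porbit IH // ltnW.
Qed.

Lemma card_cut : #|W| = i.+1.
Proof.
rewrite cardsU1 card_imset; last first.
  move=> j k /expg_porbit_inj E; apply/val_inj/succn_inj/E.
    exact: leq_ltn_trans (ltn_ord j) ip.
  exact: leq_ltn_trans (ltn_ord k) ip.
rewrite card_ord (_ : x0 \notin _) //; apply/imsetP => -[j _ /esym/eqP].
by rewrite (negbTE (expg_neq_x0 _)).
Qed.

Lemma y_notin_cut : y \notin W.
Proof.
have p0 : 0 < #|porbit R y| by apply: leq_ltn_trans ip.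
rewrite !inE (negbTE ny) /=; apply/imsetP => -[j _ E].
have := expg_porbit_inj p0 (leq_ltn_trans (ltn_ord j) ip).
by rewrite expg0 perm1 => /(_ E).
Qed.

(** Undoing the transposition of [x0] and [y] merges two cycles into that of [x0]
    together with the old cycle of [y]; so what the cut leaves is one cycle. *)
Lemma porbit_insR_rest :
  porbit (insR R y b) y = (x0 |: porbit R y) :\: W /\
  #|porbit (insR R y b) y| = #|porbit R y| - i.
Proof.
have yW := y_notin_cut; rewrite -porbit_insR_cut in yW.
have := @porbit_merge _ (insR R y b) x0 y; rewrite porbit_sym => /(_ yW).
rewrite {1}/insR tpermKl porbit_U //.
have -> : porbit R b = porbit R y by apply: porbit_perm.
rewrite porbit_insR_cut => E.
have d : [disjoint W & porbit (insR R y b) y].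
  by rewrite -porbit_insR_cut; apply: porbit_disjoint.
have EE : porbit (insR R y b) y = (x0 |: porbit R y) :\: W.
  by rewrite E setDUl setDv set0U; apply/esym/setDidPl; rewrite disjoint_sym.
split=> //; have : #|x0 |: porbit R y| = #|W| + #|porbit (insR R y b) y|.
  by rewrite E cardsU (disjoint_setI0 d) cards0 subn0.
rewrite cardsU1 porbit_neq_fix // ny card_cut add1n addSn => -[->].
by rewrite addKn.
Qed.
End Cut.

(** Old and new permutations generate each other once [x0] is connected to [y]
    and to [b]; for [b] this uses the face permutation, which sends [x0] to
    [R b]. *)
Lemma component_ins R L y b : R x0 = x0 -> L x0 = x0 ->
  component (insR R y b) (insL L y) x0 = x0 |: component R L y :|: component R L b.
Proof.
move=> Rx Lx; apply/eqP; rewrite eqEsubset; apply/andP; split.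
  set Z := _ :|: component R L b.
  have [x0Z yZ bZ] : [/\ x0 \in Z, y \in Z & b \in Z].
    by split; rewrite !inE ?component_id ?eqxx ?orbT.
  have RZ : stable R Z.
    by do !apply: stableU; try exact: stable1; exact: component_stableR.
  have LZ : stable L Z.
    by do !apply: stableU; try exact: stable1; exact: component_stableL.
  apply: component_sub => //.
    by do !apply: stableM => //; apply: stable_tperm.
  by apply: stableM => //; apply: stable_tperm.
set C := component (insR _ _ _) _ _.
have RC : stable (insR R y b) C by apply: component_stableR.
have LC : stable (insL L y) C by apply: component_stableL.
have xC : x0 \in C by apply: component_id.
have yC : y \in C by rewrite -[y](_ : insL L y x0 = y) ?LC // permM Lx tpermL.
have LC' : stable L C.
  by rewrite -(tpermKr x0 y L); apply: stableM => //; apply: stable_tperm.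
have FC := stableM LC RC; rewrite insF_E // in FC.
have RbC : R b \in C.
  rewrite -[R b](_ : insL (L * R) (R b) x0 = _) ?FC //.
  by rewrite permM permM Lx Rx tpermL.
have FC' : stable (L * R)%g C.
  by rewrite -(tpermKr x0 (R b) (L * R)%g); apply: stableM => //; apply: stable_tperm.
have RC' : stable R C by rewrite -(mulKg L R); apply: stableM => //; apply: stableV.
have bC : b \in C by rewrite -RC'.
by rewrite !subUset sub1set xC !component_sub.
Qed.

End Deletion.

(** * Euler's formula *)

Section Euler.
Variable T : finType.
Implicit Types (R L s u : {perm T}) (A V : {set T}) (x y z b : T) (D : seq nat).

Definition euler A R L g :=
  ncyc A R + ncyc A L + ncyc A (L * R) + 2 * g = #|A| + 2.

Lemma component_fix R L x : R x = x -> L x = x -> component R L x = [set x].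
Proof.
move=> Rx Lx; apply/eqP; rewrite eqEsubset sub1set component_id andbT.
by apply: component_sub; rewrite ?set11 //; apply: stable1.
Qed.

Lemma component_disjoint R L x y : y \notin component R L x ->
  [disjoint component R L x & component R L y].
Proof.
move=> nyx; rewrite disjoint_subset; apply/subsetP=> z zx; rewrite inE.
apply: contra nyx => zy; rewrite -(component_eqP zx) (component_eqP zy); exact: component_id.
Qed.

Lemma fix_notin_component x0 R L y :
  R x0 = x0 -> L x0 = x0 -> y != x0 -> x0 \notin component R L y.
Proof. by move=> Rx Lx; apply: contra; rewrite component_sym component_fix // inE. Qed.

(** Induction on the number of darts, deleting one. The genus is kept if the
    deleted dart was inserted inside one vertex or next to a single component,
    it goes up by one if two vertices of a component are merged, and it adds up
    if two components are joined. *)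
Lemma euler_genus R L x : exists g, euler (component R L x) R L g.
Proof.
have [m] := ubnP #|component R L x|; elim: m R L x => // m IH R0 L0 x0.
have [[[R L] [y b]] /= [Rx Lx] [-> ->]] : exists2 q : ({perm T} * {perm T}) * (T * T),
    q.1.1 x0 = x0 /\ q.1.2 x0 = x0 & (R0, L0) = ins x0 q.
  by exists (del x0 (R0, L0)); rewrite ?delK // !del_fix.
rewrite component_ins //; set A := _ :|: _.
have x0A : x0 \in A by rewrite !inE eqxx.
have yA : y \in A by rewrite !inE component_id orbT.
have bA : b \in A by rewrite !inE component_id !orbT.
have RA : stable R A by do !apply: stableU; try exact: stable1; exact: component_stableR.
have LA : stable L A by do !apply: stableU; try exact: stable1; exact: component_stableL.
have LRx : (L * R)%g x0 = x0 by rewrite permM Lx.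
have LRA : stable (L * R)%g A by apply: stableM.
have nR := ncyc_insR Rx RA x0A yA bA.
have nL := ncyc_insL Lx LA x0A yA.
have RbA : R b \in A by rewrite RA.
have nF := ncyc_insL LRx LRA x0A RbA; rewrite Rb_eq // in nF.
rewrite /euler insF_E // nL nF.
rewrite (cardsD1 x0) x0A ltnS => cA.
have fixU : component R L x0 = [set x0] by apply: component_fix.
have C0 z : z != x0 -> component R L z :\ x0 = component R L z.
  by move=> nz; apply/setDidPl; rewrite disjoint_sym disjoints1 fix_notin_component.
have A0 : A :\ x0 = (component R L y :\ x0) :|: (component R L b :\ x0).
  by rewrite /A !setDUl setDv set0U.
have IHz z : z \in A -> z != x0 -> exists g, euler (component R L z) R L g.
  move=> zA nz; apply: IH; apply: leq_trans cA; rewrite ltnS subset_leq_card //.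
  by rewrite -(C0 z nz) setSD //; apply: component_sub.
have RL z : stable R (component R L z) by apply: component_stableR.
have LL z : stable L (component R L z) by apply: component_stableL.
have FL z : stable (L * R)%g (component R L z) by apply: stableM.
have [ey|ny] := eqVneq y x0; have [eb|nb] := eqVneq b x0.
- move: nR A0; rewrite ey eb eqxx /= fixU setDv setU0 => nR A0.
  rewrite A0 !ncyc0 cards0 in nR *; exists 0; lia.
- have [g Eg] := IHz b bA nb; exists g; move: nR A0.
  rewrite ey nb eqxx /= fixU setDv set0U C0 // => nR A0; rewrite A0 in nR *.
  rewrite /euler in Eg; lia.
- have [g Eg] := IHz y yA ny; exists g; move: nR A0.
  rewrite eb eqxx porbit_neq_fix // (negbTE ny) /= fixU setDv setU0 C0 // => nR A0.
  rewrite A0 in nR *; rewrite /euler in Eg; lia.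
have [g Eg] := IHz y yA ny; rewrite /euler in Eg.
have [g' Eg'] := IHz b bA nb; rewrite /euler in Eg'.
rewrite !C0 // in A0; rewrite ny nb /= in nR.
have [bC|nbC] := boolP (b \in component R L y).
  move: A0; rewrite (component_eqP bC) setUid => A0; rewrite A0 in nR *.
  by case: ifP nR => _ nR; [exists g | exists g.+1]; lia.
have nby : b \in porbit R y = false.
  by apply: contraNF nbC; apply/subsetP/porbit_sub_component/component_id.
have dC := component_disjoint nbC.
have sumC s : stable s (component R L y) -> stable s (component R L b) ->
    ncyc (A :\ x0) s = ncyc (component R L y) s + ncyc (component R L b) s.
  by move=> ys bs; rewrite A0 ncycU.
have cA' : #|A :\ x0| = #|component R L y| + #|component R L b|.
  by rewrite A0 cardsU (disjoint_setI0 dC) cards0 subn0.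
rewrite nby sumC // in nR; rewrite !sumC // cA'.
exists (g + g'); lia.
Qed.

End Euler.

(** * Convolution sums *)

Definition conv k (F : nat -> nat -> nat) :=
  \sum_(i < k.+1) \sum_(j < k.+1 | i + j == k) F i j.

Lemma conv_diag k F : conv k F = \sum_(i < k.+1) F i (k - i).
Proof.
apply: eq_bigr => i _; have ki : k - i < k.+1 by rewrite ltnS leq_subr.
rewrite (big_pred1 (Ordinal ki)) // => j; rewrite [RHS]/= -val_eqE /=.
have := ltn_ord i; have := ltn_ord j; lia.
Qed.

Lemma eq_conv k F G : (forall i j, F i j = G i j) -> conv k F = conv k G.
Proof. by move=> FG; apply: eq_bigr => i _; apply: eq_bigr => j _. Qed.

Lemma conv_mulr c k F : c * conv k F = conv k (fun i j => c * F i j).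
Proof. by rewrite big_distrr; apply: eq_bigr => i _; rewrite big_distrr. Qed.

Lemma conv_sum (I : finType) (P : pred I) k F :
  conv k (fun i j => \sum_(x | P x) F x i j) = \sum_(x | P x) conv k (F x).
Proof.
rewrite !conv_diag exchange_big /=; apply: eq_bigr => x _; by rewrite conv_diag.
Qed.

Lemma conv_delta k a b c :
  conv k (fun i j => (a == i) * (b == j) * c) = (a + b == k) * c.
Proof.
rewrite conv_diag; have [ak|ak] := leqP a k.
  have ak' : a < k.+1 by [].
  rewrite (bigD1 (Ordinal ak')) //= eqxx mul1n big1 ?addn0.
    by congr (nat_of_bool _ * _); lia.
  by move=> i; rewrite -val_eqE /= eq_sym => /negbTE->.
rewrite (_ : (a + b == k) = false); last by lia.
rewrite big1 // => i _; rewrite (_ : (a == i) = false) //.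
have := ltn_ord i; lia.
Qed.

(** The factorials compensate the number [binomial #|B| i] of subsets with [i]
    elements. *)
Lemma conv_subsets (T : finType) (B : {set T}) F :
  \sum_(A : {set T} | A \subset B) (#|A|)`! * (#|B :\: A|)`! * F #|A| #|B :\: A| =
  (#|B|)`! * conv #|B| F.
Proof.
rewrite conv_diag big_distrr /=.
have cB (A : {set T}) : A \subset B -> #|A| < #|B|.+1 by rewrite ltnS; apply: subset_leq_card.
rewrite (partition_big (fun A : {set T} => inord #|A| : 'I_(#|B|.+1)) predT) //=.
apply: eq_bigr => i _; have iB : i <= #|B| by rewrite -ltnS.
rewrite (eq_bigr (fun=> i`! * (#|B| - i)`! * F i (#|B| - i))); last first.
  move=> A /andP[AB /eqP <-]; rewrite inordK ?cB //.
  by rewrite cardsD (setIidPr AB).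
rewrite sum_nat_const -(bin_fact iB) mulnA; congr (_ * _); congr (_ * _).
rewrite -cards_draws; apply: eq_card => A; rewrite !inE unfold_in.
case AB: (A \subset B) => //=.
by rewrite -val_eqE /= inordK ?cB.
Qed.

(** * Cutting a vertex *)

Section Cases.
Variables (T : finType) (x0 : T).
Implicit Types (R L s u : {perm T}) (A V : {set T}) (x y z b : T) (D : seq nat).
Notation B := [set~ x0].

Lemma perm_onB s : perm_on B s = (s x0 == x0).
Proof.
apply/idP/eqP => [sB|sx]; first by apply: out_perm sB _; rewrite !inE eqxx.
by apply/subsetP=> x; rewrite !inE; apply: contraNneq => ->; rewrite sx.
Qed.

Lemma B_stable s : s x0 = x0 -> stable s B.
Proof. by move=> sx; apply: stable_on; rewrite perm_onB sx. Qed.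

Lemma insR_eq R y b V :
  y \notin V -> b \notin V -> x0 \notin V -> {in V, R =1 insR x0 R y b}.
Proof.
move=> yV bV xV z zV; have zn w : w \notin V -> w != z by apply: contraNneq => ->.
by rewrite !permM !tpermD ?zn.
Qed.

Lemma sum_porbit R y (G : T -> nat) :
  \sum_(b in porbit R y) G b = \sum_(i < #|porbit R y|) G ((R ^+ i)%g y).
Proof.
have E : porbit R y = [set (R ^+ (i : 'I_#|porbit R y|))%g y | i in 'I_#|porbit R y|].
  apply/setP=> z; apply/idP/imsetP => [|[i _ ->]]; last exact: mem_porbit.
  by rewrite porbit_traject => /trajectP[i ip ->]; exists (Ordinal ip); rewrite ?permX.
rewrite [LHS](eq_bigl (mem
  [set (R ^+ (i : 'I_#|porbit R y|))%g y | i in 'I_#|porbit R y|])); last first.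
  by move=> z; rewrite {1}E.
rewrite big_imset //= => i j _ _ /expg_porbit_inj Eij.
by apply/val_inj/Eij; apply: ltn_ord.
Qed.

(** Only [b = R^(n-1) y] gives the root the degree [n], which requires
    [n <= #|porbit R y|]. The rest of the cycle is then a vertex of degree
    [#|porbit R y| - n.-1], to which [nroot_cycle] applies. *)
Lemma sum_same_vertex_at R y n D : R x0 = x0 -> y != x0 -> 0 < n ->
  let p := #|porbit R y| in let V := B :\: porbit R y in
  \sum_(b in porbit R y | #|porbit (insR x0 R y b) x0| == n)
     nroot (insR x0 R y b) (~: porbit (insR x0 R y b) x0) D =
  (n <= p) * (nroot R V D + \sum_(j < size D)
       (nth 0 D j == p - n.-1) * nth 0 D j * nroot R V (remove_nth j D)).
Proof.
move=> Rx ny n0 p V; rewrite big_mkcondr /= sum_porbit.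
have cE (i : 'I_p) : #|porbit (insR x0 R y ((R ^+ i)%g y)) x0| = i.+1.
  by rewrite porbit_insR_cut // card_cut.
have [np|pn] := leqP n p; last first.
  rewrite mul0n big1 // => i _; rewrite cE; case: eqP => // E.
  by move: pn (ltn_ord i); rewrite -E ltnS leqNgt => /negbTE->.
have ip : n.-1 < p by rewrite prednK.
rewrite (bigD1 (Ordinal ip)) //= big1 ?addn0; last first.
  move=> i; rewrite -val_eqE /= cE => ni; case: eqP => // E; lia.
rewrite (cE (Ordinal ip)) /= prednK // eqxx mul1n.
set b := (R ^+ _)%g y; set Q := insR x0 R y b.
have bO : b \in porbit R y by apply: mem_porbit.
have eV : {in V, R =1 Q}.
  by apply: insR_eq; rewrite !inE ?porbit_id ?bO ?eqxx //= andbF.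
have RV : stable R V by apply: stableD; [apply: B_stable | apply: stable_porbit].
have [eO cO] := porbit_insR_rest Rx ny ip; rewrite -/b -/Q in eO cO.
have dec : ~: porbit Q x0 = porbit Q y :|: V.
  rewrite eO /Q porbit_insR_cut //; apply/setP=> z.
  move/setP/(_ z): (porbit_insR_cut Rx ny ip); rewrite -/b -/Q => Ez.
  have sub : z \in porbit Q x0 -> (z == x0) || (z \in porbit R y).
    by rewrite Ez => /setU1P[->|/imsetP[j _ ->]]; rewrite ?eqxx // mem_porbit orbT.
  rewrite !in_setC -Ez in_setU in_setD -Ez in_setU1 /V in_setD in_setC1.
  case: (z \in porbit Q x0) sub => /= sub; last by case: (z == x0); case: (z \in porbit R y).
  by case/orP: (sub isT) => ->; rewrite ?andbF.
have QV := stable_eq_in RV eV.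
rewrite dec nroot_cycle //; last first.
  rewrite eO disjoint_subset; apply/subsetP=> z; rewrite !inE => /andP[_].
  by case/orP=> ->; rewrite ?andbF.
rewrite cO -/p -(eq_in_nroot _ RV eV); congr (_ + _); apply: eq_bigr => j _.
by rewrite -(eq_in_nroot _ RV eV).
Qed.

End Cases.

(** * Counting with an empty hypermap allowed *)

Lemma Hm_zero_cons g f e n D : 0 < n + size D -> Hm g 0 f e (n :: D) = 0.
Proof.
by case: n D => [|n] [|d D] //= _; rewrite /Hm /= !andbF.
Qed.

Lemma sum_rooted_Hm (T : finType) (A : {set T}) g f e n D : 0 < #|A| + n ->
  \sum_(y in A) rooted_count A y g f e n D = (#|A|)`! * Hm g #|A| f e (n :: D).
Proof.
move=> An; rewrite (eq_bigr (fun=> (#|A|.-1)`! * Hm g #|A| f e (n :: D))); last first.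
  by move=> y yA; apply: rooted_count_Hm.
rewrite sum_nat_const; have [A0|A0] := posnP #|A|.
  by rewrite A0 mul0n Hm_zero_cons ?muln0 //; lia.
by rewrite mulnA -{1}(prednK A0) -factS prednK.
Qed.

Section Extended.
Variables (T : finType) (x0 : T).
Implicit Types (R L s u : {perm T}) (A V : {set T}) (x y : T) (D : seq nat).
Implicit Types z : ({perm T} * {perm T}) * T.
Notation B := [set~ x0].

(** Either a connected hypermap on [A] with a dart of [A], or, if [A] is empty,
    the trivial pair with [x0] as a placeholder for the missing dart. Removing
    [x0] from orbits gives both cases the same description. *)
Definition pointed_on A z :=
  [&& perm_on A z.1.1, perm_on A z.1.2 & component z.1.1 z.1.2 z.2 :\ x0 == A].
Definition root_degree z := #|porbit z.1.1 z.2 :\ x0|.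
Definition root_weight A z D := nroot z.1.1 (A :\: porbit z.1.1 z.2) D.
Definition genus_on A z :=
  (#|A| + 2 - (ecyc A z.1.1 + ncyc A z.1.2 + ecyc A (z.1.2 * z.1.1)))./2.

Lemma pointed_on_set0 z : pointed_on set0 z = (z == ((1, 1), x0))%g.
Proof.
have p1 s : perm_on set0 s = (s == 1%g).
  apply/idP/eqP => [s0|->]; last exact: perm_on1.
  by apply/permP=> x; rewrite perm1 (out_perm s0) ?inE.
case: z => -[R L] y; rewrite /pointed_on /= !p1 !xpair_eqE -!andbA.
case: eqP => //= ->; case: eqP => //= ->.
rewrite component_fix ?perm1 // setD_eq0 sub1set inE.
by [].
Qed.

Lemma pointed_on_nonempty A z : x0 \notin A -> A != set0 -> pointed_on A z ->
  z.2 \in A /\ component z.1.1 z.1.2 z.2 = A.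
Proof.
case: z => -[R L] y xA A0 /and3P[/= RA LA /eqP CA].
have Rx := out_perm RA xA; have Lx := out_perm LA xA.
have ny : y != x0.
  apply: contraNneq A0 => E; rewrite -CA E component_fix //.
  by rewrite setDv.
have C' : component R L y :\ x0 = component R L y.
  by apply/setDidPl; rewrite disjoint_sym disjoints1 fix_notin_component.
by rewrite -CA C'; split; rewrite ?component_id.
Qed.

(** The truncated subtraction and the halving in [genus_on] are exact, by Euler's
    formula. *)
Lemma genus_onP A z : x0 \notin A -> pointed_on A z ->
  ecyc A z.1.1 + ncyc A z.1.2 + ecyc A (z.1.2 * z.1.1) + 2 * genus_on A z = #|A| + 2.
Proof.
move=> xA; have [->|A0] := eqVneq A set0.
  rewrite pointed_on_set0 => /eqP->; rewrite /genus_on /ecyc /= !ncyc0 eqxx cards0.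
  by [].
move=> pz; have [_ CA] := pointed_on_nonempty xA A0 pz.
have [g] := euler_genus z.1.1 z.1.2 z.2; rewrite CA /euler => E.
rewrite /genus_on /ecyc (negbTE A0) !addn0 -E addKn (mul2n g) doubleK.
by rewrite -mul2n.
Qed.

(** In the empty case both sides test the conventions of the empty hypermap. The
    factors of the summand are nested in the order in which the convolutions of
    the recurrence are evaluated. *)
Lemma extended_count A g f e n D : x0 \notin A ->
  \sum_(z | pointed_on A z) (root_degree z == n) * ((ecyc A (z.1.2 * z.1.1) == f) *
     ((ncyc A z.1.2 == e) * ((genus_on A z == g) * root_weight A z D)))
  = (#|A|)`! * Hm g #|A| f e (n :: D).
Proof.
move=> xA; have [->|A0] := eqVneq A set0.
  rewrite (eq_bigl (pred1 ((1, 1), x0)%g)); last exact: pointed_on_set0.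
  rewrite big_pred1_eq /root_degree /root_weight /genus_on /ecyc /=.
  rewrite porbit_fix ?perm1 // setDv set0D.
  rewrite !ncyc0 eqxx cards0 /= /Hm /=.
  case: g f e n D => [|g] [|[|f]] [|e] [|n] [|d D] //=.
  by rewrite big1 // => x; rewrite inE.
have Ap : 0 < #|A| by rewrite card_gt0.
rewrite -sum_rooted_Hm ?addn_gt0 ?Ap //.
rewrite (eq_bigr _ (fun y _ => big_mkcond _ _)) /= exchange_big /=.
rewrite big_mkcond -(pair_bigA _ (fun h y =>
  if pointed_on A (h, y) then (root_degree (h, y) == n) *
    ((ecyc A (h.2 * h.1) == f) * ((ncyc A h.2 == e) *
     ((genus_on A (h, y) == g) * root_weight A (h, y) D))) else 0)) /=.
apply: eq_bigr => -[R L] _; rewrite [RHS]big_mkcond /=; apply: eq_bigr => y _.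
case: ifP => [pz|npz].
  have [/= -> CA] := pointed_on_nonempty xA A0 pz.
  have := genus_onP xA pz; have /and3P[/= RA LA _] := pz.
  rewrite /hypermap_on /= RA LA CA eqxx /root_degree /root_weight /=.
  have -> : porbit R y :\ x0 = porbit R y.
    apply/setDidPl; rewrite disjoint_sym disjoints1; apply: contra xA.
    by rewrite -CA; apply/subsetP/porbit_sub_component/component_id.
  move=> E; have -> : ecyc A R + ncyc A L + ecyc A (L * R) + 2 * g == #|A| + 2 =
      (genus_on A (R, L, y) == g) by lia.
  case: (#|porbit R y| == n); last by rewrite !andbF.
  case: (ecyc A (L * R) == f); last by rewrite !andbF.
  case: (ncyc A L == e); last by rewrite !andbF.
  by case: (genus_on _ _ == g); rewrite !mul1n ?mul0n.
case: ifP => // yA; case: ifP => // /and3P[/and5P[/= RA LA _ _ _] /eqP CA _].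
case/negP: (negbT npz); rewrite /pointed_on /= RA LA CA /=.
by apply/eqP/setDidPl; rewrite disjoint_sym disjoints1.
Qed.

(** The same count with hyperedges and faces exchanged, the extra cycle of the
    empty hypermap now being a hyperedge: [y = x0] means that [x0] is inserted as
    a hyperedge of its own. *)
Lemma extended_count_dual A g f e n D : x0 \notin A ->
  \sum_(z | pointed_on A z) (root_degree z == n) * ((ncyc A (z.1.2 * z.1.1) == e) *
     ((ecyc A z.1.2 == f) * ((genus_on A z == g) * root_weight A z D)))
  = (#|A|)`! * Hm g #|A| f e (n :: D).
Proof.
move=> xA; have [A0|A0] := eqVneq A set0; last first.
  rewrite Hm_dual ?card_gt0 // -extended_count //; apply: eq_bigr => z _.
  by rewrite /ecyc (negbTE A0) !addn0.
rewrite -extended_count //; apply: eq_bigr => z _.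
by rewrite A0 /ecyc !ncyc0 eqxx; congr (_ * _); rewrite mulnCA.
Qed.

(** Restricted to one part, a product of permutations supported by disjoint parts
    is one of the factors; cycles and components are therefore local. *)
Section Glue.
Variables (A : {set T}).
Hypothesis AB : A \subset B.
Let A2 := B :\: A.

Lemma x0_notin_part : x0 \notin A.
Proof. by apply: contraTN isT => /(subsetP AB); rewrite !inE eqxx. Qed.

Lemma x0_notin_rest : x0 \notin A2.
Proof. by rewrite !inE eqxx andbF. Qed.

Lemma rest_notin_part x : x \in A2 -> x \notin A.
Proof. by case/setDP. Qed.

Lemma part_rest : A :|: A2 = B.
Proof. by rewrite -{1}(setIidPr AB) setID. Qed.

Lemma disjoint_rest : [disjoint A & A2].
Proof. by rewrite -setI_eq0 setIDA setIC -setIDA setDv setI0. Qed.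

Lemma glue_l s1 s2 : perm_on A s1 -> perm_on A2 s2 -> {in x0 |: A, s1 =1 (s1 * s2)%g}.
Proof.
move=> s1A s2A x xA; rewrite permM [in RHS](out_perm s2A) //.
case/setU1P: xA => [->|xA]; first by rewrite (out_perm s1A) ?x0_notin_part ?x0_notin_rest.
by apply: contraTN xA => /rest_notin_part; rewrite (perm_closed _ s1A).
Qed.

Lemma glue_r s1 s2 : perm_on A s1 -> perm_on A2 s2 -> {in x0 |: A2, s2 =1 (s1 * s2)%g}.
Proof.
move=> s1A s2A x xA; rewrite permM (out_perm s1A) //.
by case/setU1P: xA => [->|/rest_notin_part//]; apply: x0_notin_part.
Qed.

Lemma glue_x0 s1 s2 : perm_on A s1 -> perm_on A2 s2 -> (s1 * s2)%g x0 = x0.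
Proof. by move=> s1A s2A; rewrite permM (out_perm s1A) ?x0_notin_part // (out_perm s2A) ?x0_notin_rest. Qed.

Lemma stable_x0U s V : perm_on V s -> x0 \notin V -> stable s (x0 |: V).
Proof.
move=> sV xV; apply: stableU; last exact: stable_on.
by apply: stable1; apply: out_perm sV xV.
Qed.

Lemma component_local V R1 L1 R L y : perm_on V R1 -> perm_on V L1 -> x0 \notin V ->
  {in x0 |: V, R1 =1 R} -> {in x0 |: V, L1 =1 L} ->
  (component R L y :\ x0 == V) = (component R1 L1 y :\ x0 == V).
Proof.
move=> RV LV xV eR eL; have [yV|yV] := boolP (y \in x0 |: V).
  by rewrite (eq_in_component (stable_x0U RV xV) (stable_x0U LV xV) eR eL).
have nV R' L' : component R' L' y :\ x0 == V = false.
  apply: contraNF yV => /eqP <-; rewrite !inE component_id andbT.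
  exact: orbN.
by rewrite !nV.
Qed.

End Glue.
End Extended.

(** * Insertion inside one vertex *)

Section Assembly.
Variables (T : finType) (x0 : T).
Implicit Types (R L s u : {perm T}) (A V : {set T}) (x y b : T) (D : seq nat).
Implicit Types z : ({perm T} * {perm T}) * T.
Implicit Types q : ({perm T} * {perm T}) * (T * T).
Notation B := [set~ x0].

(** Here and below [q = ((R, L), (y, b))] stands for the data of an insertion. *)
Definition fixq q := (q.1.1 x0 == x0) && (q.1.2 x0 == x0).
Definition ins_counted g f e n q := [&& hypermap_on setT g f e (ins x0 q),
  component (ins x0 q).1 (ins x0 q).2 x0 == setT & #|porbit (ins x0 q).1 x0| == n].
Definition ins_weight D q := nroot (ins x0 q).1 (setT :\: porbit (ins x0 q).1 x0) D.

Lemma rooted_count_ins g f e n D :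
  rooted_count setT x0 g f e n D = \sum_(q | fixq q && ins_counted g f e n q) ins_weight D q.
Proof. by rewrite /rooted_count (sum_ins x0). Qed.

Lemma setT_neq0 : [set: T] == set0 = false.
Proof. by apply/negbTE/set0Pn; exists x0; rewrite inE. Qed.

Lemma setTD1 : [set: T] :\ x0 = B.
Proof. by rewrite setTD. Qed.

Lemma setUB (C : {set T}) : x0 \notin C -> (x0 |: C == setT) = (C == B).
Proof.
move=> xC; apply/eqP/eqP => [E|->].
  have <- : [set: T] :\ x0 = B by rewrite setTD.
  by rewrite -E setU1K.
by apply/setP=> x; rewrite !inE orbN.
Qed.

Lemma hypermap_on_ins R L y b g f e : R x0 = x0 -> L x0 = x0 ->
  hypermap_on setT g f e (insR x0 R y b, insL x0 L y) =
  [&& ncyc setT (insR x0 R y b) + (ncyc B L + (y == x0)) +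
        (ncyc B (L * R) + (b == x0)) + 2 * g == #|B| + 3,
      ncyc B (L * R) + (b == x0) == f & ncyc B L + (y == x0) == e].
Proof.
move=> Rx Lx; have LRx : (L * R)%g x0 = x0 by rewrite permM Lx.
have pT s : perm_on [set: T] s by apply/subsetP=> z; rewrite !inE.
rewrite /hypermap_on /= !pT /= /ecyc setT_neq0 !addn0 insF_E //.
rewrite !ncyc_insL ?inE ?Rb_eq //; try exact: stableT.
by rewrite setTD1 [#|[set: T]|](cardsD1 x0) inE setTD1 add1n addSn -addnS.
Qed.

Lemma hypermap_onB R L g f e : R x0 = x0 -> L x0 = x0 -> B != set0 ->
  hypermap_on B g f e (R, L) =
  [&& ncyc B R + ncyc B L + ncyc B (L * R) + 2 * g == #|B| + 2,
      ncyc B (L * R) == f & ncyc B L == e].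
Proof.
move=> Rx Lx B0.
by rewrite /hypermap_on /ecyc (negbTE B0) !perm_onB Rx Lx eqxx !addn0.
Qed.

Lemma ncyc_ins R y b : R x0 = x0 ->
  ncyc setT (insR x0 R y b) +
    (if (y != x0) && (b \in porbit R y) then 0 else (y != x0) + (b != x0))
  = (ncyc B R).+1.
Proof. by move=> Rx; rewrite ncyc_insR ?inE // ?setTD1 //; apply: stableT. Qed.

Lemma sum_triple (P : pred (({perm T} * {perm T}) * (T * T))) F :
  \sum_(q | P q) F q =
  \sum_h \sum_y \sum_b if P (h, (y, b)) then F (h, (y, b)) else 0.
Proof.
transitivity (\sum_h \sum_yb if P (h, yb) then F (h, yb) else 0).
  rewrite (pair_bigA _ (fun h yb => if P (h, yb) then F (h, yb) else 0)) big_mkcond.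
  by apply: eq_bigr => -[].
apply: eq_bigr => h _.
rewrite (pair_bigA _ (fun y b => if P (h, (y, b)) then F (h, (y, b)) else 0)).
by apply: eq_bigr => -[].
Qed.

Definition same_vertex q := (q.2.1 != x0) && (q.2.2 \in porbit q.1.1 q.2.1).

Lemma sum_same_vertex g f e n D : 0 < n ->
  \sum_(q | fixq q && ins_counted g f e n q && same_vertex q) ins_weight D q =
  \sum_(n <= p < #|B|.+1) (#|B|)`! * Hm g #|B| f e (p :: D) +
  \sum_(j < size D) nth 0 D j *
     ((#|B|)`! * Hm g #|B| f e (nth 0 D j + n - 1 :: remove_nth j D)).
Proof.
move=> n0.
pose cnd h y := hypermap_on B g f e h && (component h.1 h.2 y == B).
transitivity (\sum_(y in B) \sum_(h | cnd h y) (n <= #|porbit h.1 y|) *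
   (nroot h.1 (B :\: porbit h.1 y) D + \sum_(j < size D)
       (nth 0 D j == #|porbit h.1 y| - n.-1) * nth 0 D j *
         nroot h.1 (B :\: porbit h.1 y) (remove_nth j D))).
  rewrite sum_triple [RHS](exchange_big_dep predT) //=.
  apply: eq_bigr => -[R L] _.
  rewrite [RHS]big_mkcond /=; apply: eq_bigr => y _.
  have [/= /andP[/eqP Rx /eqP Lx]|nfix] := boolP (fixq (R, L, (y, y))); last first.
    rewrite big1 => [|b _]; last by rewrite /fixq /= in nfix *; rewrite (negbTE nfix).
    case: ifP => // /andP[_ /andP[/and5P[]]]; rewrite /= !perm_onB => rx lx.
    by rewrite /fixq /= rx lx in nfix.
  have [->|ny] := eqVneq y x0.
    by rewrite !inE eqxx big1 // => b _; rewrite /same_vertex /= eqxx !andbF.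
  have yB : y \in B by rewrite !inE.
  have B0 : B != set0 by apply/set0Pn; exists y.
  have gE b : b \in porbit R y -> ins_counted g f e n (R, L, (y, b)) =
      cnd (R, L) y && (#|porbit (insR x0 R y b) x0| == n).
    move=> bO; have nb : b != x0.
      by apply: contraNneq ny => eb; rewrite -(porbit_neq_fix y Rx) -eb.
    rewrite /ins_counted /ins /= component_ins // hypermap_on_ins // /cnd hypermap_onB //.
    have -> : component R L b = component R L y.
      by apply: component_eqP; apply: subsetP bO; apply/porbit_sub_component/component_id.
    rewrite -setUA setUid setUB; last exact: fix_notin_component.
    have := ncyc_ins y b Rx; rewrite ny bO (negbTE nb) (negbTE ny) /= !addn0 => ->.
    rewrite -!andbA; congr (_ && _); lia.
  case: ifP => [/andP[_ cy]|ncy]; last first.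
    rewrite big1 // => b _; case: ifP => // /andP[/andP[_ gd] /andP[_ /= bO]].
    by move: gd; rewrite gE // => /andP[cy _]; rewrite yB cy in ncy.
  rewrite -sum_same_vertex_at // [RHS]big_mkcond /=; apply: eq_bigr => b _.
  rewrite /fixq /= Rx Lx eqxx /= /same_vertex /= ny andbC /=.
  case: (boolP (b \in _)) => //= bO.
  by rewrite gE // cy /= /ins_weight setTD.
have rc y p D' : rooted_count B y g f e p D' =
    \sum_(h | cnd h y) (#|porbit h.1 y| == p) * nroot h.1 (B :\: porbit h.1 y) D'.
  rewrite /rooted_count big_mkcond [RHS]big_mkcond /=; apply: eq_bigr => h _.
  rewrite /cnd; case: (hypermap_on _ _ _ _ _) => //=; case: eqP => //= _.
  by case: eqP => //= _; rewrite mul1n.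
rewrite (eq_big_nat _ _ (F2 := fun p => \sum_(y in B) rooted_count B y g f e p D)); last first.
  by move=> p /andP[np _]; rewrite sum_rooted_Hm //; lia.
rewrite exchange_big /=.
rewrite (eq_bigr (fun j : 'I_(size D) => \sum_(y in B) nth 0 D j *
    rooted_count B y g f e (nth 0 D j + n - 1) (remove_nth j D))
  (F1 := fun j : 'I_(size D) => nth 0 D j * _)); last first.
  move=> j _; rewrite -big_distrr /=.
  have [->|d0] := posnP (nth 0 D j); first by rewrite !mul0n.
  by rewrite sum_rooted_Hm //; lia.
rewrite [X in _ = _ + X]exchange_big /= -big_split /=; apply: eq_bigr => y yB.
rewrite (eq_bigr _ (fun p _ => rc y p D)) exchange_big /=.
rewrite (eq_bigr (fun j : 'I_(size D) => \sum_(h | cnd h y) nth 0 D j *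
    ((#|porbit h.1 y| == nth 0 D j + n - 1) *
       nroot h.1 (B :\: porbit h.1 y) (remove_nth j D)))
  (F1 := fun j : 'I_(size D) => nth 0 D j * _)); last first.
  by move=> j _; rewrite rc big_distrr.
rewrite [X in _ = _ + X]exchange_big /= -big_split /=; apply: eq_bigr => -[R L] /andP[hc _] /=.
have sR : stable R B by case/and5P: hc => /= RB _ _ _ _; apply: stable_on.
have pB : #|porbit R y| <= #|B| by apply/subset_leq_card/porbit_sub.
rewrite mulnDr; congr (_ + _).
  have [np|pn] := leqP n #|porbit R y|.
    rewrite (bigD1_seq #|porbit R y|) ?iota_uniq ?mem_index_iota ?np ?ltnS //=.
    rewrite eqxx mul1n big1 ?addn0 // => p.
    by rewrite eq_sym => /negbTE->.
  rewrite mul0n big_nat_cond big1 // => p /andP[/andP[np _] _].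
  by rewrite (_ : _ == p = false) //; lia.
rewrite big_distrr /=; apply: eq_bigr => j _.
have [->|d0] := posnP (nth 0 D j); first by rewrite !(muln0, mul0n).
rewrite [in RHS]mulnA [in RHS](mulnC (nth _ _ _)) !mulnA; congr (_ * _ * _).
rewrite mulnb.
by congr (nat_of_bool _); lia.
Qed.

End Assembly.

(** * Insertion between two vertices of one component *)

Section AssemblyK.
Variables (T : finType) (x0 : T).
Implicit Types (R L s u : {perm T}) (A V : {set T}) (x y b : T) (D : seq nat).
Implicit Types q : ({perm T} * {perm T}) * (T * T).
Notation B := [set~ x0].

Definition same_component q :=
  [&& q.2.1 != x0, q.2.2 != x0, q.2.2 \notin porbit q.1.1 q.2.1 &
      q.2.2 \in component q.1.1 q.1.2 q.2.1].

Lemma ins_weight_far R L y b D : R x0 = x0 -> ~~ ((y != x0) && (b \in porbit R y)) ->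
  ins_weight x0 D ((R, L), (y, b)) = nroot R (B :\: porbit R y :\: porbit R b) D.
Proof.
move=> Rx far; rewrite /ins_weight /= porbit_insR_far //.
have -> : [set: T] :\: (x0 |: porbit R y :|: porbit R b) = B :\: porbit R y :\: porbit R b.
  by rewrite -!setDDl setTD.
symmetry; apply: eq_in_nroot.
  by do !apply: stableD; try exact: stable_porbit; apply: B_stable.
by apply: insR_eq; rewrite !inE ?porbit_id ?eqxx ?andbF.
Qed.

(** The second merged vertex plays the part of the second root in the lists
    [n - 1 - p :: p :: D]. For genus [0] there is nothing to count:
    undoing the merger would give a connected hypermap of negative genus. *)
Lemma sum_same_component g f e n D :
  \sum_(q | fixq x0 q && ins_counted x0 g f e n q && same_component q) ins_weight x0 D q =
  (1 <= g) * \sum_(1 <= p < (n - 2).+1)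
     (#|B|)`! * Hm (g - 1) #|B| f e (n - 1 - p :: p :: D).
Proof.
pose cnd h y := [&& 0 < g, hypermap_on B (g - 1) f e h & component h.1 h.2 y == B].
transitivity (\sum_(y in B) \sum_(h | cnd h y) \sum_(b in B :\: porbit h.1 y)
   (#|porbit h.1 y| + #|porbit h.1 b| == n.-1) *
     nroot h.1 (B :\: porbit h.1 y :\: porbit h.1 b) D).
  rewrite sum_triple [RHS](exchange_big_dep predT) //=.
  apply: eq_bigr => -[R L] _.
  rewrite [RHS]big_mkcond /=; apply: eq_bigr => y _.
  have [/= /andP[/eqP Rx /eqP Lx]|nfix] := boolP (fixq x0 (R, L, (y, y))); last first.
    rewrite big1 => [|b _]; last by rewrite /fixq /= in nfix *; rewrite (negbTE nfix).
    case: ifP => // /andP[_ /and3P[_ /and5P[]]]; rewrite /= !perm_onB => rx lx.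
    by rewrite /fixq /= rx lx in nfix.
  have [->|ny] := eqVneq y x0.
    by rewrite !inE eqxx big1 // => b _; rewrite /same_component /= eqxx !andbF.
  have yB : y \in B by rewrite !inE.
  have B0 : B != set0 by apply/set0Pn; exists y.
  have LRx : (L * R)%g x0 = x0 by rewrite permM Lx.
  have gE b : b != x0 -> b \notin porbit R y -> b \in component R L y ->
     ins_counted x0 g f e n (R, L, (y, b)) =
     cnd (R, L) y && (#|porbit R y| + #|porbit R b| == n.-1).
    move=> nb nbO bC; have far : ~~ ((y != x0) && (b \in porbit R y)).
      by rewrite (negbTE nbO) andbF.
    rewrite /ins_counted /ins /= component_ins // hypermap_on_ins // /cnd hypermap_onB //.
    rewrite (component_eqP bC) -setUA setUid setUB; last exact: fix_notin_component.
    rewrite porbit_insR_far // -setUA cardsU1 inE !porbit_neq_fix //.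
    rewrite (negbTE ny) (negbTE nb) add1n.
    rewrite cardsU (disjoint_setI0 (porbit_disjoint nbO)) cards0 subn0.
    have -> : ((#|porbit R y| + #|porbit R b|).+1 == n) =
        (#|porbit R y| + #|porbit R b| == n.-1).
      by have := card_porbit_neq0 R y; case: (n) => [|n'] /=; lia.
    have := ncyc_ins y b Rx; rewrite (negbTE nbO) (negbTE ny) (negbTE nb) /= => nR.
    rewrite !addn0; have [CB|] := eqVneq (component R L y) B; last by rewrite !andbF.
    have [G] := euler_genus R L y; rewrite CB /euler => EG.
    rewrite -!andbA; case: (_ == f); last by rewrite !andbF.
    case: (_ == e); last by rewrite !andbF.
    rewrite /= !andbA; congr (_ && _); lia.
  case: ifP => [/andP[_ cy]|ncy]; last first.
    rewrite big1 // => b _; case: ifP => // /andP[/andP[_ gd] /and4P[/= _ nb nbO bC]].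
    by move: gd; rewrite gE // => /andP[cy _]; rewrite yB cy in ncy.
  have /and3P[_ _ /= /eqP CB] := cy.
  rewrite [RHS]big_mkcond /=; apply: eq_bigr => b _.
  rewrite /fixq /= Rx Lx eqxx /= /same_component /= ny CB !inE.
  have [->|nb] := eqVneq b x0; first by rewrite !andbF.
  rewrite /= andbT; have [bO|nbO] := boolP (b \in porbit R y); first by rewrite andbF.
  have bC : b \in component R L y by rewrite CB !inE.
  rewrite gE // cy /= andbT ins_weight_far ?(negbTE nbO) ?andbF //.
  by case: (_ == n.-1); rewrite ?mul1n ?mul0n.
have [g0|g0] := posnP g.
  rewrite big1 // => y _; rewrite big_pred0 // => h.
  by rewrite /cnd g0.
rewrite mul1n.
rewrite [RHS](eq_big_nat _ _ (F2 := fun p =>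
  \sum_(y in B) rooted_count B y (g - 1) f e (n - 1 - p) (p :: D))); last first.
  by move=> p /andP[p0 pn]; rewrite sum_rooted_Hm //; lia.
rewrite exchange_big /=; apply: eq_bigr => y yB.
have rc p : rooted_count B y (g - 1) f e (n - 1 - p) (p :: D) =
    \sum_(h | cnd h y) \sum_(b in B :\: porbit h.1 y)
      (#|porbit h.1 y| == n - 1 - p) * (#|porbit h.1 b| == p) *
        nroot h.1 (B :\: porbit h.1 y :\: porbit h.1 b) D.
  rewrite /rooted_count big_mkcond [RHS]big_mkcond /=; apply: eq_bigr => h _.
  rewrite /cnd g0 /=; case: (hypermap_on _ _ _ _ _) => //=.
  case: (_ == B) => //=; case: eqP => /= _; last first.
    by rewrite big1.
  rewrite big_mkcondr /=; apply: eq_bigr => b _.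
  by case: (_ == p); rewrite ?mul1n ?mul0n.
rewrite (eq_bigr _ (fun p _ => rc p)) exchange_big /=; apply: eq_bigr => -[R L] _ /=.
rewrite exchange_big /=; apply: eq_bigr => b _.
have py := card_porbit_neq0 R y; have pb := card_porbit_neq0 R b.
rewrite -big_distrl /=; congr (_ * _).
have [lt|ge] := boolP (#|porbit R b| < (n - 2).+1).
  rewrite (bigD1_seq #|porbit R b|) ?iota_uniq ?mem_index_iota ?lt ?andbT ?lt0n //=.
  rewrite eqxx muln1 big1.
    by rewrite addn0; congr nat_of_bool; lia.
  by move=> p; rewrite eq_sym => /negbTE->; rewrite muln0.
rewrite big_nat_cond big1; first by rewrite (_ : _ == _ = false) //; lia.
move=> p /andP[/andP[_ pn] _].
by rewrite (_ : #|porbit R b| == p = false) ?muln0 //; lia.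
Qed.

End AssemblyK.

(** * Insertion between two components *)

Section AssemblyP.
Variables (T : finType) (x0 : T).
Implicit Types (R L s u : {perm T}) (A V : {set T}) (x y b : T) (D : seq nat).
Implicit Types q : ({perm T} * {perm T}) * (T * T).
Implicit Types z : ({perm T} * {perm T}) * T.
Notation B := [set~ x0].

Definition separated q :=
  [|| q.2.1 == x0, q.2.2 == x0 | q.2.2 \notin component q.1.1 q.1.2 q.2.1].

Definition glue (zz : (({perm T} * {perm T}) * T) * (({perm T} * {perm T}) * T)) :=
  (((zz.1.1.1 * zz.2.1.1)%g, (zz.1.1.2 * zz.2.1.2)%g), (zz.1.2, zz.2.2)).

Definition unglue A q :=
  ((restr_perm A q.1.1, restr_perm A q.1.2, q.2.1),
   (restr_perm (B :\: A) q.1.1, restr_perm (B :\: A) q.1.2, q.2.2)).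

Lemma restr_perm_stable s A x : stable s A -> x \in A -> restr_perm A s x = s x.
Proof.
move=> sA xA; apply: restr_permE => //.
by rewrite !inE; apply/subsetP=> z zA; rewrite !inE /aperm sA.
Qed.

Section FixA.
Variable A : {set T}.
Hypothesis AB : A \subset B.
Notation A2 := (B :\: A).

Lemma restrK s : s x0 = x0 -> stable s A -> (restr_perm A s * restr_perm A2 s)%g = s.
Proof.
move=> sx sA; have sA2 : stable s A2 by apply: stableD => //; apply: B_stable.
apply/permP=> x; rewrite permM; have [xA|xA] := boolP (x \in A).
  rewrite (restr_perm_stable sA xA) (out_perm (restr_perm_on A2 s)) //.
  by rewrite !inE sA xA.
rewrite (out_perm (restr_perm_on _ _) xA); have [xA2|xA2] := boolP (x \in A2).
  by rewrite restr_perm_stable.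
rewrite (out_perm (restr_perm_on _ _) xA2); move: xA2; rewrite !inE xA /= negbK.
by move/eqP->.
Qed.

Lemma restr_l s1 s2 : perm_on A s1 -> perm_on A2 s2 -> restr_perm A (s1 * s2) = s1.
Proof.
move=> s1A s2A; have e := glue_l AB s1A s2A; apply/permP=> x.
have [xA|xA] := boolP (x \in A); last by rewrite !(out_perm _ xA) ?restr_perm_on.
have st : stable (s1 * s2)%g A.
  by apply: stable_eq_in (stable_on s1A) _ => z zA; rewrite e // inE zA orbT.
by rewrite (restr_perm_stable st xA) e // inE xA orbT.
Qed.

Lemma restr_r s1 s2 : perm_on A s1 -> perm_on A2 s2 -> restr_perm A2 (s1 * s2) = s2.
Proof.
move=> s1A s2A; have e := glue_r AB s1A s2A; apply/permP=> x.
have [xA|xA] := boolP (x \in A2); last by rewrite !(out_perm _ xA) ?restr_perm_on.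
have st : stable (s1 * s2)%g A2.
  by apply: stable_eq_in (stable_on s2A) _ => z zA; rewrite e // inE zA orbT.
by rewrite (restr_perm_stable st xA) e // inE xA orbT.
Qed.

Lemma component_stableA R L y : R x0 = x0 -> L x0 = x0 ->
  component R L y :\ x0 = A -> stable R A /\ stable L A.
Proof.
by move=> Rx Lx <-; split; apply: stableD;
  (exact: component_stableR || exact: component_stableL || exact: stable1).
Qed.

Definition separates q := [&& fixq x0 q, component q.1.1 q.1.2 q.2.1 :\ x0 == A &
   component q.1.1 q.1.2 q.2.2 :\ x0 == A2].

Lemma sum_glue (F : _ -> nat) :
  \sum_(q | separates q) F q =
  \sum_(z1 | pointed_on x0 A z1) \sum_(z2 | pointed_on x0 A2 z2) F (glue (z1, z2)).
Proof.
rewrite pair_big /= (reindex_onto glue (unglue A)) /=; last first.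
  case=> [[R L] [y b]] /and3P[/andP[/= /eqP Rx /eqP Lx] /eqP Cy _].
  have [RA LA] := component_stableA Rx Lx Cy.
  by rewrite /glue /unglue /= !restrK.
apply: eq_bigl => -[[[R1 L1] y] [[R2 L2] b]]; rewrite /separates /unglue /glue /fixq /pointed_on /=.
have x2 := x0_notin_rest x0 A; have x1 := x0_notin_part AB.
apply/andP/andP => [[/and3P[/andP[/eqP Rx /eqP Lx] Cy Cb] /eqP[E1 E2 E3 E4]]|
                    [/and3P[R1A L1A Cy] /and3P[R2A L2A Cb]]].
  have R1A : perm_on A R1 by rewrite -E1 restr_perm_on.
  have L1A : perm_on A L1 by rewrite -E2 restr_perm_on.
  have R2A : perm_on A2 R2 by rewrite -E3 restr_perm_on.
  have L2A : perm_on A2 L2 by rewrite -E4 restr_perm_on.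
  rewrite R1A L1A R2A L2A /=.
  rewrite -(component_local _ R1A L1A x1 (glue_l AB R1A R2A) (glue_l AB L1A L2A)).
  rewrite -(component_local _ R2A L2A x2 (glue_r AB R1A R2A) (glue_r AB L1A L2A)).
  by rewrite Cy Cb.
rewrite (component_local _ R1A L1A x1 (glue_l AB R1A R2A) (glue_l AB L1A L2A)).
rewrite (component_local _ R2A L2A x2 (glue_r AB R1A R2A) (glue_r AB L1A L2A)).
by rewrite Cy Cb !(glue_x0 AB) // !eqxx !restr_l // !restr_r.
Qed.

Lemma pointed_on_x0 V z : pointed_on x0 V z -> x0 \notin V -> (z.2 == x0) = (V == set0).
Proof.
case: z => -[R L] y /and3P[/= RV LV /eqP CV] xV.
have Rx := out_perm RV xV; have Lx := out_perm LV xV.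
apply/eqP/eqP => [E|E]; first by rewrite -CV E component_fix // setDv.
by apply/eqP; move/setP/(_ y): CV; rewrite E !inE component_id andbT => /negbFE.
Qed.

(** Joining the two parts at [x0] merges their root vertices, adds up the genera,
    and distributes the other roots over the parts; [y = x0] and [b = x0] are
    covered by [ecyc]. *)
Lemma separated_weight g f e n D z1 z2 :
  pointed_on x0 A z1 -> pointed_on x0 A2 z2 -> 0 < n ->
  (if ins_counted x0 g f e n (glue (z1, z2)) then ins_weight x0 D (glue (z1, z2)) else 0) =
  (root_degree x0 z1 + root_degree x0 z2 == n.-1) *
  ((ecyc A2 (z2.1.2 * z2.1.1) + ncyc A (z1.1.2 * z1.1.1) == f) *
  ((ecyc A z1.1.2 + ncyc A2 z2.1.2 == e) *
  ((genus_on A z1 + genus_on A2 z2 == g) *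
   \sum_(m : (size D).-tuple bool)
      root_weight A z1 (mask m D) * root_weight A2 z2 (mask (map negb m) D)))).
Proof.
move=> p1 p2 n0; have x2 := x0_notin_rest x0 A; have x1 := x0_notin_part AB.
have G1 := genus_onP x1 p1; have G2 := genus_onP x2 p2.
have y0 := pointed_on_x0 p1 x1; have b0 := pointed_on_x0 p2 x2.
case: z1 z2 p1 p2 G1 G2 y0 b0 => [[R1 L1] y] [[R2 L2] b].
move=> /and3P[/= R1A L1A C1] /and3P[/= R2A L2A C2].
rewrite /root_degree /root_weight /glue /=.
set gn1 := genus_on _ _; set gn2 := genus_on _ _ => G1 G2 y0 b0.
have eR1 := glue_l AB R1A R2A; have eL1 := glue_l AB L1A L2A.
have eR2 := glue_r AB R1A R2A; have eL2 := glue_r AB L1A L2A.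
have Rx := glue_x0 AB R1A R2A; have Lx := glue_x0 AB L1A L2A.
have Cy := component_local y R1A L1A x1 eR1 eL1; rewrite C1 in Cy; move/eqP: Cy => Cy.
have Cb := component_local b R2A L2A x2 eR2 eL2; rewrite C2 in Cb; move/eqP: Cb => Cb.
have yA : y \in x0 |: A by rewrite -Cy !inE component_id andbT orbN.
have bA : b \in x0 |: A2 by rewrite -Cb in_setU1 in_setD1 component_id andbT orbN.
have Oy : porbit R1 y = porbit (R1 * R2)%g y.
  by apply: eq_in_porbit eR1 yA; apply: stable_x0U.
have Ob : porbit R2 b = porbit (R1 * R2)%g b.
  by apply: eq_in_porbit eR2 bA; apply: stable_x0U.
have sub1 V : {subset V <= x0 |: V} by move=> z zV; rewrite inE zV orbT.
have cy1 : ncyc A R1 = ncyc A (R1 * R2)%g.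
  by apply: eq_in_ncyc; [apply: stable_on | move=> z /sub1/eR1].
have cy2 : ncyc A2 R2 = ncyc A2 (R1 * R2)%g.
  by apply: eq_in_ncyc; [apply: stable_on | move=> z /sub1/eR2].
have cl1 : ncyc A L1 = ncyc A (L1 * L2)%g.
  by apply: eq_in_ncyc; [apply: stable_on | move=> z /sub1/eL1].
have cl2 : ncyc A2 L2 = ncyc A2 (L1 * L2)%g.
  by apply: eq_in_ncyc; [apply: stable_on | move=> z /sub1/eL2].
have cf1 : ncyc A (L1 * R1)%g = ncyc A (L1 * L2 * (R1 * R2))%g.
  apply: eq_in_ncyc; first by apply: stableM; apply: stable_on.
  by move=> z zA; rewrite permM eR1 ?sub1 ?perm_closed // eL1 ?sub1 // -permM.
have cf2 : ncyc A2 (L2 * R2)%g = ncyc A2 (L1 * L2 * (R1 * R2))%g.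
  apply: eq_in_ncyc; first by apply: stableM; apply: stable_on.
  by move=> z zA; rewrite permM eR2 ?sub1 ?perm_closed // eL2 ?sub1 // -permM.
have w1 D' : nroot R1 (A :\: porbit R1 y) D' = nroot (R1 * R2)%g (A :\: porbit R1 y) D'.
  apply: eq_in_nroot; first by apply: stableD; [apply: stable_on | apply: stable_porbit].
  by move=> z /setDP[/sub1/eR1].
have w2 D' : nroot R2 (A2 :\: porbit R2 b) D' = nroot (R1 * R2)%g (A2 :\: porbit R2 b) D'.
  apply: eq_in_nroot; first by apply: stableD; [apply: stable_on | apply: stable_porbit].
  by move=> z /setDP[/sub1/eR2].
under eq_bigr do rewrite w1 w2.
have stO1 : stable (R1 * R2)%g (A :\: porbit R1 y).
  apply: stableD; last by rewrite Oy; apply: stable_porbit.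
  by apply: stable_eq_in (stable_on R1A) _ => z /sub1/eR1.
have stO2 : stable (R1 * R2)%g (A2 :\: porbit R2 b).
  apply: stableD; last by rewrite Ob; apply: stable_porbit.
  by apply: stable_eq_in (stable_on R2A) _ => z /sub1/eR2.
have stA : stable (R1 * R2)%g A by apply: stable_eq_in (stable_on R1A) _ => z /sub1/eR1.
have stA2 : stable (R1 * R2)%g A2 by apply: stable_eq_in (stable_on R2A) _ => z /sub1/eR2.
have ltA : stable (L1 * L2)%g A by apply: stable_eq_in (stable_on L1A) _ => z /sub1/eL1.
have ltA2 : stable (L1 * L2)%g A2 by apply: stable_eq_in (stable_on L2A) _ => z /sub1/eL2.
have dA : [disjoint A & A2] by apply: disjoint_rest.
rewrite -nrootU //; last first.
  by apply: disjointWl (subsetDl _ _) _; apply: disjointWr (subsetDl _ _) _.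
rewrite Oy Ob in stO1 stO2 *.
move: G1 G2; rewrite /ecyc cy1 cy2 cl1 cl2 cf1 cf2 => G1 G2.
(* From here on, only the glued permutations matter. *)
move: (R1 * R2)%g (L1 * L2)%g Rx Lx Cy Cb stO1 stO2 stA stA2 ltA ltA2 G1 G2
  {w1 w2 eR1 eR2 eL1 eL2 Oy Ob cy1 cy2 cl1 cl2 cf1 cf2} 
  => R L Rx Lx Cy Cb stO1 stO2 stA stA2 ltA ltA2 G1 G2.
have OA : porbit R y :\ x0 \subset A.
  by rewrite -Cy setSD //; apply/porbit_sub_component/component_id.
have OA2 : porbit R b :\ x0 \subset A2.
  by rewrite -Cb setSD //; apply/porbit_sub_component/component_id.
have far : ~~ ((y != x0) && (b \in porbit R y)).
  apply/andP=> -[ny bO]; have nb : b != x0.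
    by apply: contraNneq ny => eb; rewrite -(porbit_neq_fix y Rx) -eb.
  have bA1 : b \in A by apply: (subsetP OA); rewrite !inE nb.
  have bA3 : b \in A2 by rewrite -Cb !inE nb component_id.
  by rewrite (disjointFr dA bA1) in bA3.
have BU s : stable s A -> stable s A2 -> ncyc B s = ncyc A s + ncyc A2 s.
  by move=> s1 s2; rewrite -{1}(part_rest AB) ncycU.
have cB : #|B| = #|A| + #|A2| by rewrite -{1}(part_rest AB) cardsU (disjoint_setI0 dA) cards0 subn0.
have nR := ncyc_ins y b Rx; rewrite (negbTE far) BU // y0 b0 in nR.
have dom : x0 |: component R L y :|: component R L b == setT.
  have -> : x0 |: component R L y :|: component R L b =
      x0 |: (component R L y :\ x0 :|: component R L b :\ x0).
    by apply/setP=> z; rewrite !inE; case: eqP.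
  by rewrite Cy Cb (part_rest AB) setUB // !inE eqxx.
have LRs : stable (L * R)%g A by apply: stableM.
have LRs2 : stable (L * R)%g A2 by apply: stableM.
have cO : #|porbit (insR x0 R y b) x0| = (#|porbit R y :\ x0| + #|porbit R b :\ x0|).+1.
  rewrite porbit_insR_far //.
  have -> : x0 |: porbit R y :|: porbit R b =
      x0 |: (porbit R y :\ x0 :|: porbit R b :\ x0).
    by apply/setP=> z; rewrite !inE; case: eqP.
  rewrite cardsU1 !inE eqxx /= cardsU disjoint_setI0 ?cards0 ?subn0 //.
  by apply: disjointWl OA _; apply: disjointWr OA2 _.
have wE : ins_weight x0 D (R, L, (y, b)) =
    nroot R (A :\: porbit R y :|: A2 :\: porbit R b) D.
  rewrite ins_weight_far //; congr nroot.
  apply/setP=> z; have /implyP := subsetP OA z; have /implyP := subsetP OA2 z.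
  have /implyP := subsetP AB z; rewrite !inE.
  case: (z == x0); case: (z \in A); case: (z \in porbit R y);
    by case: (z \in porbit R b).
rewrite wE /ins_counted /ins /= component_ins // dom /= hypermap_on_ins // cO.
rewrite y0 b0 !BU //.
set a1 := nat_of_bool (A == set0) in nR G1 *.
set a2 := nat_of_bool (A2 == set0) in nR G2 *.
have E1 : (ncyc A (L * R) + ncyc A2 (L * R) + a2 == f) =
    (ncyc A2 (L * R) + a2 + ncyc A (L * R) == f).
  by rewrite -addnA (addnC (ncyc A (L * R)%g)).
have E2 : (ncyc A L + ncyc A2 L + a1 == e) = (ncyc A L + a1 + ncyc A2 L == e).
  by rewrite addnAC.
rewrite E1 E2; set bf := _ == f; set be := _ == e.
rewrite -andbA; case: (boolP bf) => _; last by rewrite !andbF !mul0n muln0.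
case: (boolP be) => _; last by rewrite !andbF !mul0n !muln0.
have -> : (#|porbit R y :\ x0| + #|porbit R b :\ x0|).+1 == n =
    (#|porbit R y :\ x0| + #|porbit R b :\ x0| == n.-1).
  by rewrite -[in LHS](prednK n0) eqSS.
have -> : (ncyc setT (insR x0 R y b) + (ncyc A L + ncyc A2 L + a1) +
    (ncyc A (L * R) + ncyc A2 (L * R) + a2) + 2 * g == #|B| + 3) = (gn1 + gn2 == g).
  move: nR; rewrite cB /a1 /a2; clearbody gn1 gn2; clear -G1 G2.
  move: G1 G2; rewrite /a1 /a2; case: (A == set0); case: (A2 == set0) => /=; lia.
rewrite !mul1n /=; case: (_ == n.-1); last by rewrite andbF mul0n.
by rewrite andbT mul1n; case: (_ == g); rewrite ?mul1n ?mul0n.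
Qed.

End FixA.
End AssemblyP.

Lemma conv_pairs (I J : finType) (P : pred I) (Q : pred J) (sg tau W : I -> J -> nat) k :
  conv k (fun i j => \sum_(x | P x) \sum_(y | Q y) (sg x y == i) * ((tau x y == j) * W x y)) =
  \sum_(x | P x) \sum_(y | Q y) (sg x y + tau x y == k) * W x y.
Proof.
rewrite conv_sum; apply: eq_bigr => x _; rewrite conv_sum; apply: eq_bigr => y _.
by rewrite -conv_delta; apply: eq_conv => i j; rewrite mulnA.
Qed.

Section AssemblyP2.
Variables (T : finType) (x0 : T).
Implicit Types (R L s u : {perm T}) (A V : {set T}) (x y b : T) (D : seq nat).
Implicit Types q : ({perm T} * {perm T}) * (T * T).
Implicit Types z : ({perm T} * {perm T}) * T.
Notation B := [set~ x0].

(** The convolutions are evaluated from the innermost outwards, each collapsing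
    two constraints on the parts into one on their sum. *)
Lemma sum_separated_on A g f e n D : A \subset B -> 0 < n ->
  \sum_(q | separates x0 A q && ins_counted x0 g f e n q) ins_weight x0 D q =
  (#|A|)`! * (#|B :\: A|)`! *
  conv g (fun g1 g2 => conv e (fun f1 e2 => conv f (fun f2 e1 => conv n.-1 (fun n1 n2 =>
    \sum_(m : (size D).-tuple bool)
     Hm g1 #|A| f1 e1 (n1 :: mask m D) *
     Hm g2 #|B :\: A| f2 e2 (n2 :: mask (map negb m) D))))).
Proof.
move=> AB n0; rewrite big_mkcondr /= sum_glue //.
have x1 := x0_notin_part AB; have x2 := x0_notin_rest x0 A; set A2 := B :\: A in x2 *.
rewrite (eq_bigr _ (fun z1 p1 => eq_bigr _ (fun z2 p2 =>
  separated_weight AB g f e D p1 p2 n0))) -/A2.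
pose S z1 z2 := \sum_(m : (size D).-tuple bool)
  root_weight A z1 (mask m D) * root_weight A2 z2 (mask (map negb m) D).
(* In the convolution over the faces, the first index belongs to the second part:
   the first part enters with hyperedges and faces exchanged. *)
transitivity (conv g (fun g1 g2 => conv e (fun f1 e2 => conv f (fun f2 e1 =>
   conv n.-1 (fun n1 n2 =>
   \sum_(z1 | pointed_on x0 A z1) \sum_(z2 | pointed_on x0 A2 z2)
   (root_degree x0 z1 == n1) * ((root_degree x0 z2 == n2) * ((ecyc A2 (z2.1.2 * z2.1.1) == f2) *
    ((ncyc A (z1.1.2 * z1.1.1) == e1) * ((ecyc A z1.1.2 == f1) * ((ncyc A2 z2.1.2 == e2) *
     ((genus_on A z1 == g1) * ((genus_on A2 z2 == g2) * S z1 z2)))))))))))); last first.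
  rewrite conv_mulr; apply: eq_conv => g1 g2; rewrite conv_mulr; apply: eq_conv => f1 e2.
  rewrite conv_mulr; apply: eq_conv => f2 e1; rewrite conv_mulr; apply: eq_conv => n1 n2.
  rewrite [RHS]big_distrr /=.
  under [RHS]eq_bigr do rewrite mulnACA -(extended_count_dual _ _ _ _ _ x1)
    -(extended_count _ _ _ _ _ x2) big_distrlr /=.
  rewrite [RHS]exchange_big /=; apply: eq_bigr => z1 _.
  rewrite [RHS]exchange_big /=; apply: eq_bigr => z2 _.
  rewrite /S !big_distrr /=; apply: eq_bigr => m _.
  by do 8!case: (_ == _); rewrite ?(mul1n, mul0n, muln0).
transitivity (conv g (fun g1 g2 => conv e (fun f1 e2 => conv f (fun f2 e1 => 
   \sum_(z1 | pointed_on x0 A z1) \sum_(z2 | pointed_on x0 A2 z2)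
    (ecyc A2 (z2.1.2 * z2.1.1) == f2) * ((ncyc A (z1.1.2 * z1.1.1) == e1) *
    ((root_degree x0 z1 + root_degree x0 z2 == n.-1) * ((ecyc A z1.1.2 == f1) * ((ncyc A2 z2.1.2 == e2) *
     ((genus_on A z1 == g1) * ((genus_on A2 z2 == g2) * S z1 z2)))))))))); last first.
  apply: eq_conv => g1 g2; apply: eq_conv => f1 e2; apply: eq_conv => f2 e1.
  rewrite (conv_pairs (pointed_on x0 A) (pointed_on x0 A2) (fun z1 _ => root_degree x0 z1)
    (fun _ z2 => root_degree x0 z2)).
  apply: eq_bigr => z1 _; apply: eq_bigr => z2 _.
  by do 3!case: (_ == _); rewrite ?(mul1n, mul0n, muln0).
transitivity (conv g (fun g1 g2 => conv e (fun f1 e2 =>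
   \sum_(z1 | pointed_on x0 A z1) \sum_(z2 | pointed_on x0 A2 z2)
    (ecyc A z1.1.2 == f1) * ((ncyc A2 z2.1.2 == e2) *
    ((ecyc A2 (z2.1.2 * z2.1.1) + ncyc A (z1.1.2 * z1.1.1) == f) *
    ((root_degree x0 z1 + root_degree x0 z2 == n.-1) *
     ((genus_on A z1 == g1) * ((genus_on A2 z2 == g2) * S z1 z2)))))))); last first.
  apply: eq_conv => g1 g2; apply: eq_conv => f1 e2.
  rewrite (conv_pairs (pointed_on x0 A) (pointed_on x0 A2)
    (fun _ z2 => ecyc A2 (z2.1.2 * z2.1.1)) (fun z1 _ => ncyc A (z1.1.2 * z1.1.1))).
  apply: eq_bigr => z1 _; apply: eq_bigr => z2 _.
  by do 4!case: (_ == _); rewrite ?(mul1n, mul0n, muln0).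
transitivity (conv g (fun g1 g2 =>
   \sum_(z1 | pointed_on x0 A z1) \sum_(z2 | pointed_on x0 A2 z2)
    (genus_on A z1 == g1) * ((genus_on A2 z2 == g2) *
    ((ecyc A z1.1.2 + ncyc A2 z2.1.2 == e) *
    ((ecyc A2 (z2.1.2 * z2.1.1) + ncyc A (z1.1.2 * z1.1.1) == f) *
    ((root_degree x0 z1 + root_degree x0 z2 == n.-1) * S z1 z2)))))); last first.
  apply: eq_conv => g1 g2.
  rewrite (conv_pairs (pointed_on x0 A) (pointed_on x0 A2) (fun z1 _ => ecyc A z1.1.2)
    (fun _ z2 => ncyc A2 z2.1.2)).
  apply: eq_bigr => z1 _; apply: eq_bigr => z2 _.
  by do 5!case: (_ == _); rewrite ?(mul1n, mul0n, muln0).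
rewrite (conv_pairs (pointed_on x0 A) (pointed_on x0 A2) (fun z1 _ => genus_on A z1)
  (fun _ z2 => genus_on A2 z2)).
apply: eq_bigr => z1 _; apply: eq_bigr => z2 _; rewrite -/(S z1 z2).
by do 4!case: (_ == _); rewrite ?(mul1n, mul0n, muln0).
Qed.

(** The part of [y] is its component without [x0]. *)
Lemma sum_separated g f e n D : 0 < n ->
  \sum_(q | fixq x0 q && ins_counted x0 g f e n q && separated x0 q) ins_weight x0 D q =
  (#|B|)`! *
  conv g (fun g1 g2 => conv #|B| (fun t1 t2 => conv e (fun f1 e2 =>
    conv f (fun f2 e1 => conv n.-1 (fun n1 n2 =>
    \sum_(m : (size D).-tuple bool)
     Hm g1 t1 f1 e1 (n1 :: mask m D) *
     Hm g2 t2 f2 e2 (n2 :: mask (map negb m) D)))))).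
Proof.
move=> n0; rewrite conv_mulr.
under eq_conv do rewrite -conv_subsets.
rewrite conv_sum (partition_big (fun q => component q.1.1 q.1.2 q.2.1 :\ x0)
  (fun A => A \subset B)) /=; last first.
  by move=> q _; apply/subsetP=> z; rewrite !inE => /andP[].
apply: eq_bigr => A AB; rewrite -conv_mulr -sum_separated_on //.
apply: eq_bigl => -[[R L] [y b]].
rewrite /separates; case fq: (fixq x0 _); last by rewrite !andFb.
have [Rx Lx] : R x0 = x0 /\ L x0 = x0 by move: fq => /andP[/eqP ? /eqP ?].
have C0 (z w : T) : z \in component R L w -> z != x0 -> w != x0.
  by move=> zw; apply: contraNneq => E; move: zw; rewrite E component_fix // inE.
case gd: (ins_counted x0 g f e n _); last by rewrite !andbF.
have /and3P[_ /eqP dom _] := gd; rewrite /= component_ins // in dom.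
rewrite !andTb andbT; case: eqP => [/= CA|_]; last by rewrite andbF.
rewrite andbT; apply/idP/eqP => [cP|Cb].
  apply/setP=> z; rewrite !inE -CA !inE negb_and negbK andbC.
  have [->|nz] := eqVneq z x0; first by rewrite andbF.
  rewrite /= andbT; have := in_setT z; rewrite -dom !inE (negbTE nz) /=.
  have [zy /= _|_ /= -> //] := boolP (z \in component R L y).
  apply/negbTE/negP=> zb; move: cP.
  rewrite /separated /= (negbTE (C0 _ _ zy nz)) (negbTE (C0 _ _ zb nz)) /=.
  by rewrite -(component_eqP zy) (component_eqP zb) component_id.
rewrite /separated /=; apply/or3P; have [->|ny] := eqVneq y x0; first by constructor 1.
have [->|nb] := eqVneq b x0; first by constructor 2.
constructor 3; apply/negP=> bC.
have bA : b \in A by rewrite -CA !inE nb bC.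
have : b \in B :\: A by rewrite -Cb !inE nb component_id.
by rewrite inE bA.
Qed.

(** * The recurrence *)

Lemma rooted_count_recursion g f e n D : 0 < n ->
  rooted_count [set: T] x0 g f e n D = (#|B|)`! * (
  conv g (fun g1 g2 => conv #|B| (fun t1 t2 => conv e (fun f1 e2 =>
    conv f (fun f2 e1 => conv n.-1 (fun n1 n2 =>
    \sum_(m : (size D).-tuple bool)
     Hm g1 t1 f1 e1 (n1 :: mask m D) *
     Hm g2 t2 f2 e2 (n2 :: mask (map negb m) D))))))
  + (1 <= g) * \sum_(1 <= p < (n - 2).+1) Hm (g - 1) #|B| f e (n - 1 - p :: p :: D)
  + \sum_(n <= p < #|B|.+1) Hm g #|B| f e (p :: D)
  + \sum_(j < size D) nth 0 D j * Hm g #|B| f e (nth 0 D j + n - 1 :: remove_nth j D)).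
Proof.
move=> n0; rewrite rooted_count_ins (bigID (@same_vertex T x0)) /= sum_same_vertex //.
rewrite (bigID (@same_component T x0)) /=.
rewrite [X in _ + (X + _)](eq_bigl (fun q =>
  fixq x0 q && ins_counted x0 g f e n q && same_component x0 q)); last first.
  move=> -[[R L] [y b]]; rewrite -andbA; congr (_ && _).
  rewrite /same_vertex /same_component /=.
  by case: (y == x0); case: (b == x0); case: (b \in porbit R y).
rewrite [X in _ + (_ + X)](eq_bigl (fun q =>
  fixq x0 q && ins_counted x0 g f e n q && separated x0 q)); last first.
  move=> -[[R L] [y b]]; case fq: (fixq x0 _) => //=; rewrite -andbA; congr (_ && _).
  have Rx : R x0 = x0 by move: fq => /andP[/eqP].
  rewrite /same_vertex /same_component /separated /=; have [//|ny] /= := eqVneq y x0.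
  have [->|nb] /= := eqVneq b x0; first by rewrite porbit_neq_fix // ny.
  have [bO|//] /= := boolP (b \in porbit R y).
  by apply/esym/negbTE; rewrite negbK; apply: subsetP bO; apply/porbit_sub_component/component_id.
rewrite sum_same_component sum_separated //= !mulnDr [LHS]addnC; set K := _ * \sum_(1 <= p < _) _.
rewrite [K + _]addnC {}/K [in RHS]mulnCA addnA !big_distrr /=; congr (_ + _ + _ + _).
by apply: eq_bigr => j _; rewrite mulnCA.
Qed.

End AssemblyP2.

(** Without darts both sides vanish, unless the list is the one of the empty
    hypermap, for which the exchange fails. *)
Lemma Hm_dual_cons g t f e n D : 0 < t + n + size D ->
  Hm g t f e (n :: D) = Hm g t e f (n :: D).
Proof.
have [->|t0 _] := posnP t; last exact: Hm_dual.
by move=> nD; rewrite !Hm_zero_cons.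
Qed.

Theorem theorem4 :
  Hm 0 0 1 0 [:: 0] = 1 /\
  forall t n : nat, 1 <= t -> 1 <= n ->
  forall (g f e : nat) (D : seq nat), all (fun d => 1 <= d) D ->
    Hm g t f e (n :: D) =
      \sum_(g1 < g.+1) \sum_(g2 < g.+1 | g1 + g2 == g)
      \sum_(t1 < t) \sum_(t2 < t | t1 + t2 == t - 1)
      \sum_(f1 < e.+1) \sum_(e2 < e.+1 | f1 + e2 == e)
      \sum_(f2 < f.+1) \sum_(e1 < f.+1 | f2 + e1 == f)
      \sum_(n1 < n) \sum_(n2 < n | n1 + n2 == n - 1)
      \sum_(m : (size D).-tuple bool)
         Hm g1 t1 f1 e1 ((n1 : nat) :: mask m D) *
         Hm g2 t2 f2 e2 ((n2 : nat) :: mask (map negb m) D)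
    + (3 <= n) * (1 <= g) *
      \sum_(1 <= p < (n - 2).+1) Hm (g - 1) (t - 1) e f (n - 1 - p :: p :: D)
    + \sum_(n <= p < (t - 1).+1) Hm g (t - 1) e f (p :: D)
    + \sum_(j < size D)
        nth 0 D j *
        Hm g (t - 1) e f (nth 0 D j + n - 1 :: remove_nth j D).
Proof.
split=> // -[//|t] [//|n] _ _ g f e D /allP Dpos.
have cB : #|[set~ (ord0 : 'I_t.+1)]| = t by rewrite cardsC1 card_ord.
have := rooted_count_recursion (ord0 : 'I_t.+1) g f e D (ltn0Sn n).
rewrite rooted_count_Hm ?inE // cardsT card_ord cB /= => /eqP.
rewrite eqn_pmul2l ?fact_gt0 // => /eqP ->; rewrite !subn1 /=.
congr (_ + _ + _ + _).
- have [n3|n3] := ltnP 2 n.+1; last first.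
    by rewrite !mul0n big_geq ?muln0 // (_ : n.+1 - 2 = 0) //; lia.
  rewrite mul1n; congr (_ * _); apply: eq_big_nat => p /andP[p0 pn].
  by rewrite Hm_dual_cons //=; lia.
- by apply: eq_big_nat => p /andP[np _]; rewrite Hm_dual_cons //=; lia.
apply: eq_bigr => j _; congr (_ * _); rewrite Hm_dual_cons //.
have := Dpos _ (mem_nth 0 (ltn_ord j)).
by move: (nth 0 D j) => d; lia.
Qed.
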